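(* Let $k$ be a field, let $S=k[x_1,\dots,x_n]$, and let $M\subset S$ be a generic (proper) monomial ideal. Then $M$ is Cohen-Macaulay (i.e. $S/M$ is a Cohen-Macaulay ring) if and only if $\dim(\Delta_M)+\dim(V(M))=n-2$, where $\Delta_M$ is the Scarf complex of $M$ and $V(M)$ is the simplicial complex whose Stanley-Reisner ideal is $\mathrm{rad}(M)$.
   Context: For monomials, $x^{a}=x_1^{a_1}\cdots x_n^{a_n}$ strictly divides $x^{b}$ if $a_i<b_i$ for every $i$ with $a_i>0$. A monomial ideal $M$ with minimal monomial generators $m_1,\dots,m_t$ is generic if for any two distinct minimal generators $m_i,m_j$ having the same positive degree in some variable $x_h$, there is a third minimal generator $m_l$ that strictly divides $\mathrm{lcm}(m_i,m_j)$. Scarf complex: for $\sigma\subseteq[t]=\{1,\dots,t\}$ let $m_\sigma=\mathrm{lcm}(m_i: i\in\sigma)$ (with $m_\emptyset=1$); then $\Delta_M=\{\sigma\subseteq[t] : m_\sigma\neq m_\tau \text{ for all } \tau\subseteq[t],\ \tau\neq\sigma\}$. $V(M)$ is the simplicial complex of all $\sigma\subseteq[n]$ such that $\prod_{i\in\sigma}x_i\notin \mathrm{rad}(M)$ (here it is not required that every $\{i\}$ be a face). The dimension of a face $\sigma$ is $|\sigma|-1$, and the dimension of a complex is the maximum dimension of its faces (so the complex $\{\emptyset\}$ has dimension $-1$). *)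

(* Defs.v *)
From HB Require Import structures.
From mathcomp Require Import all_boot all_order all_algebra.
From mathcomp Require Import ring_quotient boolp mpoly.

Set Implicit Arguments.
Unset Strict Implicit.
Unset Printing Implicit Defensive.

Import GRing.Theory.

Local Open Scope ring_scope.

(* f belongs to the ideal of R generated by the F i with i in A. *)
Definition in_gen_ideal (R : comNzRingType) (I : finType) (A : {set I})
    (F : I -> R) (f : R) : Prop :=
  exists c : I -> R, f = \sum_(i in A) c i * F i.

(* An [idealr] is proper by definition, so the unit ideal, generated by 1, is
   left out of the quantification at no loss. *)
Definition noetherian (R : comNzRingType) : Prop :=
  forall I : idealr R, exists (d : nat) (x : 'I_d -> R),
    forall f : R, f \in I <-> in_gen_ideal [set: 'I_d] x f.

Definition maximal_ideal (R : comNzRingType) (P : idealr R) : Prop :=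
  forall Q : idealr R, {subset P <= Q} -> {subset Q <= P}.

(* (x_0, ..., x_(d-1)) R <> R, and x_i is a nonzerodivisor modulo
   (x_0, ..., x_(i-1)) for every i. *)
Definition regular_sequence (R : comNzRingType) (d : nat) (x : 'I_d -> R) :
    Prop :=
  ~ in_gen_ideal [set: 'I_d] x 1 /\
  forall (i : 'I_d) (f : R),
    in_gen_ideal [set j : 'I_d | (j < i)%N] x (x i * f) ->
    in_gen_ideal [set j : 'I_d | (j < i)%N] x f.

Definition is_greatest (A : nat -> Prop) (d : nat) : Prop :=
  A d /\ forall e : nat, A e -> (e <= d)%N.

Definition has_depth (R : comNzRingType) (P : idealr R) : nat -> Prop :=
  is_greatest (fun d => exists x : 'I_d -> R,
    regular_sequence x /\ forall i, x i \in P).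

(* Strictly increasing chains Q_0 < ... < Q_d = P of prime ideals. *)
Definition has_codim (R : comNzRingType) (P : idealr R) : nat -> Prop :=
  is_greatest (fun d => exists Q : 'I_d.+1 -> prime_idealr R,
    (forall i j : 'I_d.+1, (i < j)%N ->
       {subset Q i <= Q j} /\ ~ {subset Q j <= Q i}) /\
    Q ord_max =i P).

(* Eisenbud, Commutative Algebra, Section 18.2: depth(P, R) = codim P for
   every maximal ideal P of the noetherian ring R.  Both numbers are unchanged
   by localizing at P, so this says that every R_P is Cohen-Macaulay. *)
Definition cohen_macaulay (R : comNzRingType) : Prop :=
  noetherian R /\
  forall P : idealr R, maximal_ideal P ->
    exists d : nat, has_depth P d /\ has_codim P d.

(* The monomials generate M, and no proper subfamily of them does. *)
Definition minimal_monomial_generators (k : fieldType) (n t : nat)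
    (M : idealr {mpoly k[n]}) (m : 'I_t -> 'X_{1..n}) : Prop :=
  let generated_by (s : {set 'I_t}) := forall f : {mpoly k[n]},
    f \in M <-> in_gen_ideal s (fun i => 'X_[m i]) f in
  generated_by [set: 'I_t] /\
  forall s : {set 'I_t}, generated_by s -> s = [set: 'I_t].

Definition strictly_divides (n : nat) (a b : 'X_{1..n}) : bool :=
  [forall i, (0 < a i)%N ==> (a i < b i)%N].

Definition generic (n t : nat) (m : 'I_t -> 'X_{1..n}) : Prop :=
  forall (i j : 'I_t) (h : 'I_n),
    i != j -> m i h = m j h -> (0 < m i h)%N ->
    exists l : 'I_t, [/\ l != i, l != j &
      strictly_divides (m l) (mlcm (m i) (m j))].

Definition lcm_label (n t : nat) (m : 'I_t -> 'X_{1..n}) (s : {set 'I_t}) :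
    'X_{1..n} :=
  \big[@mlcm n/0%MM]_(i in s) m i.

Definition scarf_complex (n t : nat) (m : 'I_t -> 'X_{1..n}) :
    {set {set 'I_t}} :=
  [set s | [forall u : {set 'I_t},
    (u != s) ==> (lcm_label m s != lcm_label m u)]].

Definition in_radical (R : comNzRingType) (I : idealr R) (f : R) : Prop :=
  exists N : nat, f ^+ N \in I.

(* The simplicial complex V(M), whose Stanley-Reisner ideal is rad(M). *)
Definition radical_complex (k : fieldType) (n : nat)
    (M : idealr {mpoly k[n]}) : {set {set 'I_n}} :=
  [set s : {set 'I_n} |
    `[< ~ in_radical M (\prod_(i in s) 'X_i : {mpoly k[n]}) >]].

(* Meant for D nonempty; a complex always contains the face set0. *)
Definition complex_dim (T : finType) (D : {set {set T}}) : int :=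
  (\max_(s in D) #|s|)%N%:Z - 1.

(* Main.v *)
Require Import Defs.
From HB Require Import structures.
From mathcomp Require Import all_boot all_order all_algebra.
From mathcomp Require Import ring_quotient boolp mpoly.
From mathcomp Require Import ring zify.
From mathcomp Require classical_sets.

Set Implicit Arguments.
Unset Strict Implicit.
Unset Printing Implicit Defensive.

Import GRing.Theory.

Local Open Scope ring_scope.

(* Let D be the largest size of a face of V(M), and p that of a face of the
   Scarf complex; the claim is that M is Cohen-Macaulay iff p + D = n.

   Genericity makes p the largest number of variables that annihilate a common
   nonzero monomial of S/M: a Scarf face with label x^b provides such a monomial
   by lowering one suitable exponent of b per generator, and conversely
   genericity turns generators witnessing the annihilation into a Scarf face.
   In particular p + D >= n.

   A regular sequence y_1, ..., y_d at the origin has d <= n - p: if p variables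
   annihilate a monomial z of S/M, more than n - p powers y_i^N satisfy a
   polynomial relation modulo these variables, and its lexicographically lowest
   term puts z in M + (y_1^N, ..., y_d^N) for every N.  The same elimination
   bounds chains of primes of S/M by D.  At the origin a chain of monomial
   primes of length D exists, so Cohen-Macaulayness gives D <= n - p.

   Conversely, let p + D = n.  A generic monomial ideal I is taken apart by exact
   sequences 0 -> S/(I : u) -> S/I -> S/(I + u) -> 0 with monomials u, down to
   ideals generated by n - D variables.  On these the powers of the elementary
   symmetric polynomials e_D, ..., e_1 form a weakly regular sequence, hence so
   they do on S/M, and then so does any sequence with these top-degree forms.
   A maximal ideal P contains monic polynomials g_i(e_i) by Zariski's lemma, so
   it contains a regular sequence of length D; this yields a chain of primes of
   length D below P, and D bounds both depth and codimension. *)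

(** * Weakly regular sequences *)

Section Ideals.
Variable R : comNzRingType.
Implicit Types (I J : R -> Prop) (a b c f g u : R) (s : seq R).

(** Ideals are predicates here because colon ideals and sums may become the unit ideal, which
    [idealr] excludes. *)
Definition is_ideal I : Prop :=
  [/\ I 0, forall f g, I f -> I g -> I (f + g) & forall a f, I f -> I (a * f)].

Definition ideal_add I a : R -> Prop :=
  fun f => exists b c, I b /\ f = b + c * a.

Definition colon I u : R -> Prop := fun f => I (f * u).

(** No properness is demanded: over the unit ideal every sequence qualifies, which lets inductions
    run through unit ideals. *)
Fixpoint weakly_regular I s : Prop :=
  if s is a :: s' then
    (forall f, I (a * f) -> I f) /\ weakly_regular (ideal_add I a) s'
  else True.

Lemma idealN I f : is_ideal I -> I f -> I (- f).
Proof. by case=> _ _ IM If; rewrite -mulN1r; apply: IM. Qed.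

Lemma idealB I f g : is_ideal I -> I f -> I g -> I (f - g).
Proof.
by move=> idI If Ig; case: (idI) => _ ID _; apply: ID => //;
  apply: idealN.
Qed.

Lemma ideal_sum I (T : Type) (r : seq T) (P : pred T) (F : T -> R) :
  is_ideal I -> (forall i, P i -> I (F i)) -> I (\sum_(i <- r | P i) F i).
Proof. by case=> I0 ID _ IF; elim/big_ind: _. Qed.

Lemma ideal_addP I a : is_ideal I -> is_ideal (ideal_add I a).
Proof.
case=> I0 ID IM; split; first by exists 0, 0; split=> //; ring.
- move=> f g [b [c [Ib ->]]] [b' [c' [Ib' ->]]].
  by exists (b + b'), (c + c'); split; [exact: ID | ring].
- move=> d f [b [c [Ib ->]]].
  by exists (d * b), (d * c); split; [exact: IM | ring].
Qed.

Lemma ideal_add_sub I a f : I f -> ideal_add I a f.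
Proof. by move=> If; exists f, 0; split=> //; ring. Qed.

Lemma ideal_add_gen I a : is_ideal I -> ideal_add I a a.
Proof. by case=> I0 _ _; exists 0, 1; split=> //; ring. Qed.

Lemma colonP I u : is_ideal I -> is_ideal (colon I u).
Proof.
case=> I0 ID IM; rewrite /colon; split; first by rewrite mul0r.
- by move=> f g If Ig; rewrite mulrDl; apply: ID.
- by move=> a f If; rewrite -mulrA; apply: IM.
Qed.

Lemma ideal_add_mono I J a f :
  (forall g, I g -> J g) -> ideal_add I a f -> ideal_add J a f.
Proof. by move=> IJ [b [c [Ib ->]]]; exists b, c; split=> //; apply: IJ. Qed.

Lemma ideal_add_congr I a b : is_ideal I -> I (a - b) ->
  forall f, ideal_add I a f <-> ideal_add I b f.
Proof.
move=> idI; have [_ ID IM] := idI.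
suff imp a' b' : I (a' - b') -> forall f, ideal_add I a' f -> ideal_add I b' f.
  by move=> Iab f; split; apply: imp => //; rewrite -opprB; apply: idealN.
move=> Iab f [c [d [Ic ->]]]; exists (c + d * (a' - b')), d; split;
  last by ring.
by apply: ID => //; apply: IM.
Qed.

Lemma weakly_regular_ext I J s :
  (forall f, I f <-> J f) -> weakly_regular I s -> weakly_regular J s.
Proof.
elim: s I J => [|a s IHs] I J IJ //= [aI sI]; split.
  by move=> f /IJ /aI /IJ.
by apply: IHs sI => f; split; apply: ideal_add_mono => g /IJ.
Qed.

Lemma weakly_regular_unit I s : is_ideal I -> I 1 -> weakly_regular I s.
Proof.
elim: s I => [|a s IHs] I idI I1 //=; split.
  by move=> f _; rewrite -[f]mulr1; case: idI => _ _; apply.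
by apply: IHs; [apply: ideal_addP | apply: ideal_add_sub].
Qed.

(* The exact sequence 0 -> R/(I : u) -> R/I -> R/(I + u) -> 0 stays exact modulo
   a weakly regular sequence. *)
Lemma weakly_regular_split I u s : is_ideal I ->
  weakly_regular (colon I u) s -> weakly_regular (ideal_add I u) s ->
  weakly_regular I s.
Proof.
elim: s I => [|a s IHs] I idI //= [aC sC] [aA sA].
have [I0 ID IM] := idI.
have nzd f : I (a * f) -> I f.
  move=> Iaf; have /aA [b [c [Ib Ef]]] := ideal_add_sub u Iaf.
  rewrite Ef; apply: ID => //; apply: aC; rewrite /colon.
  have -> : a * c * u = a * f - a * b by rewrite Ef; ring.
  by apply: idealB => //; apply: IM.
split=> //; apply: IHs; first exact: ideal_addP.
(* [(I : u) + (a)] equals [(I + (a)) : u], because [a] is a nonzerodivisor modulo [I + (u)]. *)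
- apply: weakly_regular_ext sC => f; split=> [] [b [c [Ib Ef]]].
    by exists (b * u), (c * u); split=> //; rewrite Ef; ring.
  have /aA [b' [c' [Ib' Ec]]] : ideal_add I u (a * c).
    exists (- b), f; split; first exact: idealN.
    by rewrite mulrC Ef; ring.
  exists (f - c' * a), c'; split; last by ring.
  rewrite /colon mulrBl Ef Ec.
  have -> : b + (b' + c' * u) * a - c' * a * u = b + a * b' by ring.
  by apply: ID => //; apply: IM.
- apply: weakly_regular_ext sA => f; split=> [] [b [c [[b' [c' [Ib' ->]]] ->]]].
    by exists (b' + c * a), c'; split; [exists b', c | ring].
  by exists (b' + c * u), c'; split; [exists b', c | ring].
Qed.

(** The ideal [I + (a^(N+1))] is split along [a^N]: the colon ideal is [I + (a)] and the sum is
    [I + (a^N)], so induction on [N] applies. *)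
Lemma weakly_regular_exp I s N : is_ideal I ->
  weakly_regular I s -> weakly_regular I [seq a ^+ N | a <- s].
Proof.
elim: s I => [|a s IHs] I idI //= [aI sI].
have aNI e f : I (a ^+ e * f) -> I f.
  elim: e => [|e IHe]; first by rewrite expr0 mul1r.
  by rewrite exprS -mulrA => /aI.
split; first exact: aNI.
apply: IHs; first exact: ideal_addP.
elim: N => [|N IHN].
  apply: weakly_regular_unit; first exact: ideal_addP.
  by rewrite expr0; apply: ideal_add_gen.
apply: (weakly_regular_split (u := a ^+ N)); first exact: ideal_addP.
- apply: weakly_regular_ext sI => f; rewrite /colon; have [I0 ID IM] := idI.
  split=> [] [b [c [Ib Ef]]].
    exists (b * a ^+ N), c; split; first by rewrite mulrC; apply: IM.
    by rewrite Ef exprS; ring.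
  exists (f - c * a), c; split; last by ring.
  apply: (aNI N).
  have -> : a ^+ N * (f - c * a) = f * a ^+ N - c * a ^+ N.+1 by rewrite
    exprS; ring.
  by rewrite Ef addrK.
- apply: weakly_regular_ext IHN => f; split=>
    [|[b [c [[b' [c' [Ib' ->]]] ->]]]].
    by apply: ideal_add_mono => g; apply: ideal_add_sub.
  by exists b', (c + c' * a); split=> //; rewrite exprS; ring.
Qed.

Definition ideal_adds I s : R -> Prop := foldl ideal_add I s.

Lemma ideal_addsP I s : is_ideal I -> is_ideal (ideal_adds I s).
Proof. by elim: s I => [|a s IHs] I idI //=; apply/IHs/ideal_addP. Qed.

Lemma ideal_adds_le I J s : is_ideal J -> (forall f, I f -> J f) ->
  (forall a, a \in s -> J a) -> forall f, ideal_adds I s f -> J f.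
Proof.
move=> [J0 JD JM]; elim: s I => [|a s IHs] I IJ sJ //=; apply: IHs.
  move=> f [b [c [Ib ->]]]; apply: JD; first exact: IJ.
  by apply/JM/sJ; rewrite mem_head.
by move=> b bs; apply: sJ; rewrite inE bs orbT.
Qed.

Lemma ideal_adds_sub I s f : I f -> ideal_adds I s f.
Proof. by elim: s I => [|a s IHs] I If //=; apply/IHs/ideal_add_sub. Qed.

Lemma ideal_adds_gen I s a : is_ideal I -> a \in s -> ideal_adds I s a.
Proof.
elim: s I => [|b s IHs] I idI //=; rewrite inE => /orP[/eqP-> | /IHs];
  last first.
  by apply; apply: ideal_addP.
exact/ideal_adds_sub/ideal_add_gen.
Qed.

Lemma weakly_regularP I s : weakly_regular I s <->
  forall i f, (i < size s)%N ->
    ideal_adds I (take i s) (s`_i * f) -> ideal_adds I (take i s) f.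
Proof.
elim: s I => [|a s IHs] I; first by split.
split=> [[aI /IHs sI] [|i] f lti //= | sI]; first exact: aI.
  exact: sI.
split; first by move=> f; apply: (sI 0%N f).
by apply/IHs => i f lti; have := sI i.+1 f lti.
Qed.

End Ideals.

(** * Regular sequences as lists *)

Section RegularSequences.
Variable R : comNzRingType.

Lemma in_gen_ideal_set0 (T : finType) (F : T -> R) f :
  in_gen_ideal set0 F f <-> f = 0.
Proof.
split=> [[c ->]|->]; first by rewrite big_set0.
by exists (fun=> 0); rewrite big_set0.
Qed.

Lemma in_gen_idealU1 (T : finType) (A : {set T}) a (F : T -> R) f :
  a \notin A ->
  in_gen_ideal (a |: A) F f <-> ideal_add (in_gen_ideal A F) (F a) f.
Proof.
move=> aA; split.
  case=> c ->; rewrite big_setU1 //=.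
  by exists (\sum_(i in A) c i * F i), (c a); split; [exists c | rewrite addrC].
case=> _ [d [[c ->] ->]]; exists (fun i => if i == a then d else c i).
rewrite big_setU1 //= eqxx addrC; congr (_ + _); apply: eq_bigr => i iA.
by rewrite (negPf (memPn aA i iA)).
Qed.

Lemma in_gen_ideal_take d (x : 'I_d -> R) i f : (i <= d)%N ->
  in_gen_ideal [set j : 'I_d | (j < i)%N] x f <->
  ideal_adds (fun g => g = 0) (take i (codom x)) f.
Proof.
elim: i f => [|i IHi] f lei.
  rewrite take0 /= -(in_gen_ideal_set0 x).
  by rewrite (_ : [set j : 'I_d | (j < 0)%N] = set0) //; apply/setP=> j;
    rewrite !inE.
pose a := Ordinal lei.
have -> : [set j : 'I_d | (j < i.+1)%N] = a |: [set j : 'I_d | (j < i)%N].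
  by apply/setP=> j; rewrite !inE ltnS leq_eqVlt.
have ltis : (i < size (codom x))%N by rewrite size_codom card_ord.
rewrite in_gen_idealU1 ?inE ?ltnn // (take_nth 0 ltis) /ideal_adds foldl_rcons.
have -> : (codom x)`_i = x a.
  rewrite /codom /image_mem (nth_map a) -?cardE ?card_ord //; congr x.
  by apply: val_inj; rewrite /= nth_enum_ord.
by split; apply: ideal_add_mono => g /(IHi _ (ltnW lei)).
Qed.

Lemma in_gen_ideal_codom d (x : 'I_d -> R) f :
  in_gen_ideal [set: 'I_d] x f <-> ideal_adds (fun g => g = 0) (codom x) f.
Proof.
rewrite -[codom x](@take_oversize _ d) ?size_codom ?card_ord //.
rewrite -in_gen_ideal_take // (_ : [set j : 'I_d | (j < d)%N] = [set: 'I_d]) //.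
by apply/setP=> j; rewrite !inE ltn_ord.
Qed.

Lemma regular_sequenceP d (x : 'I_d -> R) :
  regular_sequence x <->
  ~ ideal_adds (fun g => g = 0) (codom x) 1 /\
  weakly_regular (fun g => g = 0) (codom x).
Proof.
have nth_x (i : 'I_d) : (codom x)`_i = x i.
  by rewrite /codom /image_mem (nth_map i) ?nth_ord_enum // -cardE card_ord.
have sz : size (codom x) = d by rewrite size_codom card_ord.
rewrite /regular_sequence in_gen_ideal_codom weakly_regularP sz.
split=> [[? reg]|[? reg]]; split=> //.
  move=> i f lti; rewrite -!in_gen_ideal_take ?(ltnW lti) //.
  by rewrite (nth_x (Ordinal lti)); apply: reg.
move=> i f; rewrite !in_gen_ideal_take ?(ltnW (ltn_ord i)) //.
by rewrite -nth_x; apply: reg.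
Qed.

End RegularSequences.

(** * Transfer along surjective ring morphisms *)

Section Transfer.
Variables (A B : comNzRingType) (phi : {rmorphism A -> B}).
Hypothesis phi_surj : forall y, exists x, phi x = y.

Lemma weakly_regular_preim (J : B -> Prop) s :
  weakly_regular J (map phi s) <-> weakly_regular (fun f => J (phi f)) s.
Proof.
elim: s J => [|a s IHs] J //=; rewrite IHs.
have E f : ideal_add J (phi a) (phi f) <-> ideal_add (fun g => J (phi g)) a f.
  split=> [[b [c [Jb Ef]]]|[b [c [Jb ->]]]].
    have [c' Ec] := phi_surj c; exists (f - c' * a), c'; split; last by ring.
    by rewrite rmorphB rmorphM Ec Ef addrK.
  by exists (phi b), (phi c); rewrite rmorphD rmorphM.
split=> [] [aJ sJ]; split.
- by move=> f; rewrite rmorphM => /aJ.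
- exact: weakly_regular_ext E sJ.
- by move=> f; have [f' <-] := phi_surj f; rewrite -rmorphM => /aJ.
- by apply: weakly_regular_ext sJ => f; apply: iff_sym.
Qed.

Lemma ideal_adds_preim (J : B -> Prop) s f :
  ideal_adds J (map phi s) (phi f) <-> ideal_adds (fun f => J (phi f)) s f.
Proof.
elim: s J => [|a s IHs] J //=; rewrite IHs.
have E g : ideal_add J (phi a) (phi g) <-> ideal_add (fun g => J (phi g)) a g.
  split=> [[b [c [Jb Ef]]]|[b [c [Jb ->]]]].
    have [c' Ec] := phi_surj c; exists (g - c' * a), c'; split; last by ring.
    by rewrite rmorphB rmorphM Ec Ef addrK.
  by exists (phi b), (phi c); rewrite rmorphD rmorphM.
suff EE (K L : A -> Prop) : (forall g, K g <-> L g) ->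
    ideal_adds K s f <-> ideal_adds L s f by apply: EE.
elim: (s) K L => [|b s' IH] K L KL //=; apply: IH => g.
by split; apply: ideal_add_mono => h /KL.
Qed.

End Transfer.

(** * Monomial ideals *)

Section MonomialIdeals.
Variables (k : fieldType) (n : nat).
Implicit Types (G : seq 'X_{1..n}) (f : {mpoly k[n]}) (a b g u w : 'X_{1..n}).

Definition divisible_by G b : bool := has (fun g => (g <= b)%MM) G.

(** Membership is read off the support, since a monomial ideal contains a polynomial exactly when it
    contains each of its monomials. *)
Definition mono_ideal G f : Prop := {in msupp f, forall b, divisible_by G b}.

Lemma divisible_byP G b :
  reflect (exists2 g, g \in G & (g <= b)%MM) (divisible_by G b).
Proof. exact: hasP. Qed.

Lemma divisible_by_mono G a b : (a <= b)%MM -> divisible_by G a ->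
  divisible_by G b.
Proof.
by move=> ab /divisible_byP[g gG ga]; apply/divisible_byP; exists g => //;
  apply: lepm_trans ab.
Qed.

Lemma divisible_by_sub G G' : {in G, forall g, divisible_by G' g} ->
  forall b, divisible_by G b -> divisible_by G' b.
Proof.
by move=> GG' b /divisible_byP[g /GG' g' gb];
  apply: divisible_by_mono g'.
Qed.

Lemma divisible_by_eq G G' :
  {in G, forall g, divisible_by G' g} -> {in G', forall g, divisible_by G g} ->
  divisible_by G =1 divisible_by G'.
Proof.
by move=> GG' G'G b; apply/idP/idP; apply: divisible_by_sub.
Qed.

Lemma mem_divisible_by G g : g \in G -> divisible_by G g.
Proof. by move=> gG; apply/divisible_byP; exists g => //; apply: lepm_refl. Qed.

Lemma lemB g u b : ((g - u)%MM <= b)%MM = (g <= b + u)%MM.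
Proof.
apply/mnm_lepP/mnm_lepP => h i; have := h i; rewrite mnmBE mnmDE; lia.
Qed.

(** Subtraction of exponents is truncated, so [g - u] stands for [g / gcd(g, u)], the usual
    generator of a colon ideal. *)
Lemma divisible_by_colon G u b :
  divisible_by [seq (g - u)%MM | g <- G] b = divisible_by G (b + u)%MM.
Proof.
by rewrite /divisible_by has_map; apply: eq_has => g /=;
  rewrite lemB.
Qed.

Lemma mono_idealP G : is_ideal (mono_ideal G).
Proof.
split; first by move=> b; rewrite msupp0.
- move=> f g fG gG b /msuppD_le; rewrite mem_cat => /orP[/fG | /gG] //.
- move=> f g gG b /msuppM_le /allpairsP[[b1 b2] /= [_ /gG b2G ->]].
  by apply: divisible_by_mono b2G; apply: lem_addl.
Qed.

Lemma mono_idealX G b : mono_ideal G 'X_[b] <-> divisible_by G b.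
Proof.
split=> [|bG c]; first by apply; rewrite msuppX mem_head.
by rewrite msuppX inE => /eqP->.
Qed.

Lemma mono_ideal_eq G G' : divisible_by G =1 divisible_by G' ->
  forall f, mono_ideal G f <-> mono_ideal G' f.
Proof. by move=> GG' f; split=> fG b /fG; rewrite GG'. Qed.

Lemma weakly_regular_mono_eq G G' s : divisible_by G =1 divisible_by G' ->
  weakly_regular (mono_ideal G) s -> weakly_regular (mono_ideal G') s.
Proof. by move=> /mono_ideal_eq E; apply: weakly_regular_ext. Qed.

Lemma mono_ideal_colon G u f :
  colon (mono_ideal G) 'X_[u] f <-> mono_ideal [seq (g - u)%MM | g <- G] f.
Proof.
rewrite /colon; split=> fG b.
  move=> bf; rewrite divisible_by_colon; apply: fG.
  by rewrite (perm_mem (msuppMX _ _)) addmC map_f.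
rewrite (perm_mem (msuppMX _ _)) => /mapP[c cf ->].
by rewrite addmC -divisible_by_colon; apply: fG.
Qed.

Lemma mono_ideal_add G u f :
  ideal_add (mono_ideal G) 'X_[u] f <-> mono_ideal (u :: G) f.
Proof.
split.
  have [_ ID IM] := mono_idealP (u :: G).
  case=> b [c [bG ->]]; apply: ID; last first.
    by apply/IM/mono_idealX/mem_divisible_by; rewrite mem_head.
  by move=> x /bG xG; rewrite /divisible_by /= -/(divisible_by _ _) xG orbT.
move=> fG; exists (\sum_(b <- msupp f | divisible_by G b) f@_b *: 'X_[b]).
exists (\sum_(b <- msupp f | ~~ divisible_by G b) f@_b *: 'X_[b - u]); split.
  have [_ _ IM] := mono_idealP G.
  apply: ideal_sum; first exact: mono_idealP.
  by move=> b bG; rewrite -mul_mpolyC; apply/IM/mono_idealX.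
rewrite mulr_suml {1}[f]mpolyE (bigID (divisible_by G)) /=; congr (_ + _).
rewrite big_seq_cond [RHS]big_seq_cond; apply: eq_bigr =>
  b /andP[/fG bG /negPf nG].
rewrite -scalerAl -mpolyXD submK //.
by move: bG; rewrite /divisible_by /= -/(divisible_by _ _) nG orbF.
Qed.

Lemma mono_ideal_split G u s :
  weakly_regular (mono_ideal [seq (g - u)%MM | g <- G]) s ->
  weakly_regular (mono_ideal (u :: G)) s -> weakly_regular (mono_ideal G) s.
Proof.
move=> sC sA; apply: (weakly_regular_split (u := 'X_[u]));
  first exact: mono_idealP.
  by apply: weakly_regular_ext sC => f; rewrite mono_ideal_colon.
by apply: weakly_regular_ext sA => f; rewrite mono_ideal_add.
Qed.

Lemma mono_ideal_gen t (m : 'I_t -> 'X_{1..n}) f :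
  in_gen_ideal [set: 'I_t] (fun i => 'X_[m i]) f <-> mono_ideal (codom m) f.
Proof.
split=> [[c ->]|fG].
  apply: ideal_sum => [|i _]; first exact: mono_idealP.
  have [_ _ IM] := mono_idealP (codom m).
  by apply/IM/mono_idealX/mem_divisible_by/codom_f.
have /choice[idx idxP] b : exists i : option 'I_t, b \in msupp f ->
    if i is Some i then (m i <= b)%MM else false.
  case: (boolP (b \in msupp f)) => [/fG/divisible_byP[_ /codomP[i ->] ib]|_].
    by exists (Some i).
  by exists None.
exists (fun i => \sum_(b <- msupp f | idx b == Some i) f@_b *: 'X_[b - m i]).
under eq_bigr do rewrite mulr_suml.
rewrite (exchange_big_dep predT) //= {1}[f]mpolyE big_seq [RHS]big_seq.
apply: eq_bigr => b /idxP; case Ei: (idx b) => [i|] // ib.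
rewrite (big_pred1 i) => [|j]; last by rewrite inE /= eq_sym.
by rewrite -scalerAl -mpolyXD submK.
Qed.

End MonomialIdeals.

(** * Powers of elementary symmetric polynomials *)

Section ElementarySymmetric.
Variables (k : fieldType) (n : nat).
Implicit Types (B : {set 'I_n}) (b w : 'X_{1..n}).

Definition variables B : seq 'X_{1..n} := [seq U_(i)%MM | i <- enum B].

Lemma variablesP B b : reflect (exists2 i, i \in B & (0 < b i)%N)
  (divisible_by (variables B) b).
Proof.
apply: (iffP (divisible_byP _ _)) => [[_ /mapP[i iB ->]]|[i iB bi]].
  by rewrite lep1mP -lt0n; exists i => //; rewrite -mem_enum.
by exists U_(i)%MM; rewrite ?lep1mP -?lt0n //; apply: map_f; rewrite mem_enum.
Qed.

(** Modulo the variables of [B], only the product of all the other variables survives in the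
    elementary symmetric polynomial of that degree. *)
Lemma mesym_variables B (e : nat) :
  mono_ideal (variables B) (mesym n k #|~: B| ^+ e - 'X_[mesym1 (~: B) *+ e]).
Proof.
have [_ _ IM] := mono_idealP k (variables B).
rewrite -mpolyXn subrXX mulrC; apply: IM.
rewrite mesymE (bigD1 (~: B)) //= addrAC subrr add0r.
apply: ideal_sum => [|h /andP[/eqP ch hB]]; first exact: mono_idealP.
apply/mono_idealX/variablesP.
have /subsetPn[i ih iB] : ~~ (h \subset ~: B).
  by apply: contra hB => hB; rewrite eqEcard hB ch /=.
by exists i; [rewrite inE negbK in iB | rewrite mnmE ih].
Qed.

(* The degrees decrease: modulo all variables outside a set of r of them, the
   first entry is a power of the product of these r variables. *)
Fixpoint mesym_powers (d : nat -> nat) r : seq {mpoly k[n]} :=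
  if r is r'.+1 then mesym n k r ^+ d r :: mesym_powers d r' else [::].

(** One variable [z] is split off [w] at a time: with [w' = w/z], the colon ideal by [w'] is
    generated by [z] and [B], and adding [w'] leaves [w'] and [B]. *)
Lemma weakly_regular_mono_variables (s : seq {mpoly k[n]}) B w :
  (forall z, z \notin B ->
    weakly_regular (mono_ideal (variables (z |: B))) s) ->
  (forall i, i \in B -> w i = 0%N) ->
  weakly_regular (mono_ideal (w :: variables B)) s.
Proof.
move=> regB; have [N] := ubnP (mdeg w); elim: N w => // N IHN w /ltnSE degw wB.
have [->|w0] := eqVneq w 0%MM.
  apply: weakly_regular_unit; first exact: mono_idealP.
  by move=> b _; apply/divisible_byP; exists 0%MM; rewrite ?mem_head //;
    apply/mnm_lepP=> i; rewrite mnm0E.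
have [z wz] : exists z, (0 < w z)%N.
  case: (pickP (fun z => 0 < w z)%N) => [z|w0']; first by exists z.
  by case/eqP: w0; apply/mnmP=> i; rewrite mnm0E; have := w0' i; lia.
have zB : z \notin B by apply/negP=> /wB; lia.
pose w' := (w - U_(z))%MM.
have zw : (U_(z) <= w)%MM by rewrite lep1mP -lt0n.
have Ew : w = (w' + U_(z))%MM by rewrite submK.
apply: (mono_ideal_split (u := w')).
  apply: weakly_regular_ext (regB z zB); apply: mono_ideal_eq => b.
  rewrite divisible_by_colon.
  apply/variablesP/divisible_byP.
    move=> [i]; rewrite !inE => /orP[/eqP->|iB] bi.
      exists w; rewrite ?mem_head // Ew; apply/mnm_lepP=> j.
      by rewrite !mnmDE mnm1E; case: eqP => [<-|_] /=; lia.
    exists U_(i)%MM; first by rewrite inE map_f ?orbT ?mem_enum.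
    by rewrite lep1mP mnmDE; lia.
  move=> [g]; rewrite inE => /orP[/eqP->|/mapP[i]].
    by move/mnm_lepP/(_ z); rewrite mnmDE mnmBE mnm1E eqxx; exists z;
      [rewrite !inE eqxx | lia].
  rewrite mem_enum => iB ->; rewrite lep1mP mnmDE mnmBE wB // => bi.
  by exists i; [rewrite !inE iB orbT | lia].
have -> : weakly_regular (mono_ideal [:: w', w & variables B]) s =
          weakly_regular (mono_ideal (w' :: variables B)) s.
  apply/propext; split; apply: weakly_regular_ext; apply: mono_ideal_eq => b;
    rewrite /divisible_by /=; have := lem_addr w' U_(z); rewrite -Ew => ww';
    case: (boolP (w <= b)%MM) => // /(lepm_trans ww') -> //.
apply: IHN; last by move=> i /wB; rewrite mnmBE => ->.
have := mdegD w' U_(z); rewrite -Ew mdeg1; lia.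
Qed.

(** Modulo [B] the first entry is a monomial in the remaining variables, hence a nonzerodivisor;
    modulo it, the tail is treated by enlarging [B] by one variable. *)
Lemma weakly_regular_variables d r B : #|~: B| = r ->
  weakly_regular (mono_ideal (variables B)) (mesym_powers d r).
Proof.
elim: r B => [|r IHr] B cB //=.
have idB := mono_idealP k (variables B).
have congB := @mesym_variables B (d r.+1); rewrite cB in congB.
have ZB i : i \in B -> (mesym1 (~: B) *+ d r.+1)%MM i = 0%N.
  by move=> iB; rewrite mulmnE mnmE inE iB.
split.
  move=> f ef b bf.
  have [_ ID IM] := idB.
  have fX : mono_ideal (variables B) (f * 'X_[mesym1 (~: B) *+ d r.+1]).
    have -> : f * 'X_[mesym1 (~: B) *+ d r.+1] = mesym n k r.+1 ^+ d r.+1 * f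
        - f * (mesym n k r.+1 ^+ d r.+1 - 'X_[mesym1 (~: B) *+ d r.+1]) by ring.
    exact: idealB idB ef (IM _ _ congB).
  have := fX (mesym1 (~: B) *+ d r.+1 + b)%MM;
    rewrite (perm_mem (msuppMX _ _)) map_f // => /(_ isT).
  move/variablesP => [i iB]; rewrite mnmDE ZB // add0n => bi.
  by apply/variablesP; exists i.
suff: weakly_regular (mono_ideal ((mesym1 (~: B) *+ d r.+1)%MM :: variables B))
    (mesym_powers d r).
  apply: weakly_regular_ext => f.
  by rewrite -mono_ideal_add; apply: iff_sym; apply: ideal_add_congr.
apply: weakly_regular_mono_variables => // z zB; apply: IHr.
rewrite (_ : ~: (z |: B) = (~: B) :\ z); last first.
  by apply/setP=> i; rewrite !inE negb_or.
by have := cardsD1 z (~: B); rewrite cB !inE zB; lia.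
Qed.
End ElementarySymmetric.

(** * Generic monomial ideals *)

Section GenericSplitting.
Variable n : nat.
Implicit Types (G : seq 'X_{1..n}) (a b c g u w : 'X_{1..n}).

Lemma strictly_dividesP a b :
  reflect (forall i, (0 < a i -> a i < b i)%N) (strictly_divides a b).
Proof. by apply: (iffP forallP) => h i; [apply/implyP | apply/implyP/h]. Qed.

(** Stated for a list of exponents that may be redundant, since the splitting below does not keep
    generators minimal. *)
Definition generic_seq G : Prop := forall a b h, a \in G -> b \in G ->
  a != b -> a h = b h -> (0 < a h)%N ->
  exists2 c, c \in G & strictly_divides c (mlcm a b).

(* Every associated prime of the ideal generated by G has height at most p. *)
Definition socle_bound G p : Prop := forall u, ~~ divisible_by G u ->
  (#|[set h | divisible_by G (u + U_(h))%MM]| <= p)%N.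

(* Every prime ideal containing the ideal generated by G has height at least p. *)
Definition height_bound G p : Prop := forall B : {set 'I_n},
  {in G, forall g, divisible_by (variables B) g} -> (p <= #|B|)%N.

Lemma mlcm_apply a b i : mlcm a b i = maxn (a i) (b i).
Proof. exact: mnmE. Qed.

Variables (G : seq 'X_{1..n}) (g : 'X_{1..n}) (v : 'I_n).
Hypotheses (G_generic : generic_seq G) (gG : g \in G) (gv : (0 < g v)%N).
Hypothesis g_min : forall c, c \in G -> (0 < c v)%N -> (g v <= c v)%N.

(** The ideal is split along [u = g/x_v]. By the choice of [g], a generator involving [x_v] becomes
    a multiple of [x_v] in [I : u], so [x_v] can replace it there. *)
Let u := (g - U_(v))%MM.
(* Gadd generates I + (u) and Gcolon generates I : u, where I is generated by G. *)
Let Gadd := u :: [seq c <- G | c != g].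
Let Gcolon := U_(v)%MM :: [seq (c - u)%MM | c <- G & c v == 0%N].

Let Eg : g = (u + U_(v))%MM.
Proof. by rewrite submK // lep1mP -lt0n. Qed.

Let gE i : g i = (u i + (v == i))%N.
Proof. by rewrite {1}Eg mnmDE mnm1E. Qed.

Lemma divisible_by_Gadd : divisible_by Gadd =1 divisible_by (u :: G).
Proof.
apply: divisible_by_eq => c; rewrite inE => /orP[/eqP->|].
- by apply: mem_divisible_by; rewrite mem_head.
- rewrite mem_filter => /andP[_ cG]; apply: mem_divisible_by.
  by rewrite inE cG orbT.
- by apply: mem_divisible_by; rewrite mem_head.
- move=> cG; have [->|cg] := eqVneq c g.
    by apply/divisible_byP; exists u; rewrite ?mem_head // lem_subr.
  by apply: mem_divisible_by; rewrite inE mem_filter cg cG orbT.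
Qed.

Lemma divisible_by_Gcolon :
  divisible_by Gcolon =1 divisible_by [seq (c - u)%MM | c <- G].
Proof.
apply: divisible_by_eq => c; rewrite ?inE.
- case/orP=> [/eqP->|/mapP[c' c'G ->]].
    apply/divisible_byP; exists (g - u)%MM; first exact: map_f.
    by rewrite Eg addmC addmK lepm_refl.
  by apply: mem_divisible_by; apply: map_f; rewrite mem_filter in c'G;
    case/andP: c'G.
- case/mapP=> c' c'G ->; have [c'v|c'v] := posnP (c' v).
    apply: mem_divisible_by; rewrite inE; apply/orP; right.
    by apply: map_f; rewrite mem_filter c'v eqxx.
  apply/divisible_byP; exists U_(v)%MM; rewrite ?mem_head // lep1mP mnmBE.
  by have := g_min c'G c'v; have := gE v; rewrite eqxx; lia.
Qed.

(** A strict divisor equal to [g] is replaced by [u]. An exponent shared by [u] and [b] cannot be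
    that of [x_v], where [u] lies below the least positive value, so [g] and [b] share it too. *)
Lemma Gadd_generic : generic_seq Gadd.
Proof.
suff gen_u b h : b \in G -> b != g -> u h = b h -> (0 < u h)%N ->
    exists2 c, c \in Gadd & strictly_divides c (mlcm u b).
  move=> a b h; rewrite !inE !mem_filter.
  case/orP=> [/eqP->|/andP[ag aG]] /orP[/eqP->|/andP[bg bG]]; rewrite ?eqxx //.
  - by move=> _; apply: gen_u.
  - move=> _ Eab ah; have [|c cG' cd] := gen_u a h aG ag (esym Eab);
      first by rewrite -Eab.
    by exists c => //; rewrite mlcmC.
  move=> ab Eab ah; have [c cG /strictly_dividesP cd] :=
    G_generic aG bG ab Eab ah.
  have [Ec|cg] := eqVneq c g; last first.
    by exists c; [rewrite inE mem_filter cg cG orbT | apply/strictly_dividesP].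
  exists u; first by rewrite mem_head.
  by apply/strictly_dividesP => i ui; have := cd i; rewrite Ec gE; lia.
move=> bG bg Eub uh.
have vh : v != h.
  apply/eqP=> vh; rewrite -vh in Eub uh.
  by have := g_min bG; have := gE v; rewrite eqxx; lia.
have Egh : g h = b h by rewrite gE (negPf vh) addn0.
have [c cG /strictly_dividesP cd] : exists2 c, c \in G &
  strictly_divides c (mlcm g b).
  by apply: (G_generic gG bG (h := h)); rewrite ?Egh -?Eub // eq_sym.
exists c.
  rewrite inE mem_filter cG andbT; apply/orP; right; apply/eqP=> Ec.
  by have := cd h; rewrite Ec mlcm_apply Egh; lia.
apply/strictly_dividesP=> i ci; have := cd i ci; rewrite !mlcm_apply gE.
have [Evi|vi] := eqVneq v i; last by rewrite addn0.
rewrite -Evi in ci *; have := g_min cG ci; have := gE v; rewrite eqxx; lia.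
Qed.

(** A strict divisor of the lcm of two generators free of [x_v] is itself free of [x_v], so it is
    kept. *)
Lemma Gcolon_generic : generic_seq Gcolon.
Proof.
have colv c : c v = 0%N -> (c - u)%MM v = 0%N by rewrite mnmBE => ->.
move=> a b h; rewrite !inE.
move=> /orP[/eqP->|/mapP[a' + ->]] /orP[/eqP->|/mapP[b' + ->]];
  rewrite ?eqxx ?mem_filter //.
- case/andP=> /eqP b'v _ _; rewrite mnm1E; have [<-|//] := eqVneq v h.
  by rewrite colv.
- case/andP=> /eqP a'v _ _; rewrite mnm1E; have [<-|_ ->] := eqVneq v h;
    last by [].
  by rewrite colv.
case/andP=> /eqP a'v a'G /andP[/eqP b'v b'G] ab; rewrite !mnmBE => Eab ah.
have ab' : a' != b' by apply: contra ab => /eqP->.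
have [Eab' ah'] : a' h = b' h /\ (0 < a' h)%N by lia.
have [c cG /strictly_dividesP cd] := G_generic a'G b'G ab' Eab' ah'.
have cv : c v = 0%N by have := cd v; rewrite mlcm_apply a'v b'v; lia.
exists (c - u)%MM.
  by rewrite inE; apply/orP; right; apply: map_f; rewrite mem_filter cv cG eqxx.
apply/strictly_dividesP=> i; have := cd i; rewrite !mlcm_apply !mnmBE; lia.
Qed.

Lemma Gcolon_socle p : socle_bound G p -> socle_bound Gcolon p.
Proof.
move=> Gp w; rewrite divisible_by_Gcolon divisible_by_colon => /Gp.
apply: leq_trans; apply/subset_leq_card/subsetP=> h; rewrite !inE.
by rewrite divisible_by_Gcolon divisible_by_colon -!addmA [(U_(h) + u)%MM]addmC.
Qed.

(** It suffices to replace [w], outside [I + (u)], by a monomial [w'] outside [I] such that every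
    variable taking [w] into [I + (u)] takes [w'] into [I]. The choice is [w] or [w x_v]. *)
Lemma Gadd_socle p : socle_bound G p -> socle_bound Gadd p.
Proof.
move=> Gp w wG.
suff [w' w'G sub] : exists2 w', ~~ divisible_by G w' &
    forall h, divisible_by Gadd (w + U_(h)) -> divisible_by G (w' + U_(h)).
  apply: leq_trans (Gp w' w'G).
  by apply/subset_leq_card/subsetP=> h; rewrite !inE; apply: sub.
have GaddE b : divisible_by Gadd b = (u <= b)%MM || divisible_by G b.
  exact: divisible_by_Gadd.
have [nuw nGw] : ~~ (u <= w)%MM /\ ~~ divisible_by G w.
  by move: wG; rewrite GaddE negb_or => /andP[].
have gE' b : (g <= b)%MM -> divisible_by G b by move=> gb; apply/divisible_byP;
  exists g.
have uge b : (u <= b)%MM -> (g v <= b v)%N -> divisible_by G b.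
  move=> /mnm_lepP ub gb; apply: gE'; apply/mnm_lepP=> i; rewrite gE.
  have [<-|_] := eqVneq v i; last by rewrite addn0.
  by have := gE v; rewrite eqxx => <-.
have [all_in|] :=
  boolP [forall h, divisible_by Gadd (w + U_(h)) ==> divisible_by G
  (w + U_(h))].
  by exists w => // h; apply/implyP/(forallP all_in).
rewrite negb_forall => /existsP[h0]; rewrite negb_imply GaddE.
case/andP=> /orP[uh0|->//] nGh0.
(* A multiple of [u] with [x_v]-exponent at least [g v] lies in [I], so this exponent is exactly
   [g v - 1]. *)
have wh0 : ((w + U_(h0))%MM v).+1 = g v.
  have : ~ (g v <= (w + U_(h0))%MM v)%N by move=> /(uge _ uh0); apply/negP.
  by have := mnm_lepP uh0 v; have := gE v; rewrite eqxx; lia.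
have [Eh0|vh0] := eqVneq v h0.
  rewrite -Eh0 in uh0 nGh0 wh0.
  exists (w + U_(v))%MM => // h; rewrite GaddE =>
    /orP[/mnm_lepP uh|/divisible_by_mono Gh].
    have [->|hv] := eqVneq h v.
      rewrite {1}[divisible_by _ _]gE' // Eg; apply/mnm_lepP=> i.
      by rewrite !mnmDE leq_add2r; have := mnm_lepP uh0 i; rewrite mnmDE.
    have := uh v; rewrite !mnmDE !mnm1E eqxx in wh0 *.
    by have := gE v; rewrite (negPf hv) eqxx; lia.
  by apply: Gh; apply/mnm_lepP=> i; rewrite !mnmDE; lia.
rewrite mnmDE mnm1E eq_sym (negPf vh0) addn0 in wh0.
(* If [w x_v] were in [I], a generator [c] dividing it would share with [g] the exponent of [x_v];
   genericity would give a generator [q] free of [x_v] dividing [w x_h0], which lies outside [I]. *)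
have [Gv|nGv] := boolP (divisible_by G (w + U_(v))).
  have [c cG cw] := divisible_byP _ _ Gv.
  have cv : (w v < c v)%N.
    rewrite ltnNge; apply/negP=> cv; case/negP: nGw; apply/divisible_byP;
      exists c => //.
    apply/mnm_lepP=> i; have := mnm_lepP cw i; rewrite mnmDE mnm1E.
    by have [<- //|_] := eqVneq v i; rewrite addn0.
  have Ecv : c v = g v.
    by have := mnm_lepP cw v; rewrite mnmDE mnm1E eqxx; lia.
  have cg : g != c.
    apply/eqP=> Egc; case/negP: nuw; apply/mnm_lepP=> i.
    by have := mnm_lepP cw i; rewrite -Egc mnmDE mnm1E gE leq_add2r.
  have [q qG /strictly_dividesP qd] := G_generic gG cG cg (esym Ecv) gv.
  case/negP: nGh0; apply/divisible_byP; exists q => //; apply/mnm_lepP=> i.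
  have [->//|qi] := posnP (q i).
  have := qd i qi; rewrite mlcm_apply.
  have [Evi|vi] := eqVneq v i.
    by rewrite -Evi in qi *; rewrite Ecv maxnn; have := g_min qG qi; lia.
  rewrite gE (negPf vi) addn0.
  have := mnm_lepP uh0 i; have := mnm_lepP cw i;
    rewrite !mnmDE !mnm1E (negPf vi); lia.
exists (w + U_(v))%MM => // h; rewrite GaddE => /orP[uh|/divisible_by_mono Gh];
  last first.
  by apply: Gh; apply/mnm_lepP=> i; rewrite !mnmDE; lia.
apply: uge; first apply: lepm_trans uh _.
  by apply/mnm_lepP=> i; rewrite !mnmDE; lia.
by rewrite !mnmDE mnm1E eqxx; lia.
Qed.

Lemma Gadd_height p : height_bound G p -> height_bound Gadd p.
Proof.
move=> Gp B BG; apply: Gp => c cG.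
apply: (divisible_by_sub BG); rewrite divisible_by_Gadd.
by apply: mem_divisible_by; rewrite inE cG orbT.
Qed.

Lemma Gcolon_height p : height_bound G p -> height_bound Gcolon p.
Proof.
move=> Gp B BG; apply: Gp => c cG.
apply: (divisible_by_sub BG); rewrite divisible_by_Gcolon divisible_by_colon.
by apply: divisible_by_mono (mem_divisible_by cG); apply: lem_addr.
Qed.

Lemma sum_mdeg_filter :
  (\sum_(c <- G | c != g) mdeg c + mdeg g <= \sum_(c <- G) mdeg c)%N.
Proof.
rewrite (big_rem _ gG) /= eqxx add0n addnC [X in (_ <= X)%N](big_rem _ gG) /=
  leq_add2l.
by rewrite big_mkcond leq_sum // => c _; case: ifP.
Qed.

Lemma mdeg_u : mdeg g = (mdeg u).+1.
Proof. by rewrite Eg mdegD mdeg1 addn1. Qed.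

Lemma Gadd_size : (\sum_(c <- Gadd) mdeg c < \sum_(c <- G) mdeg c)%N.
Proof.
by rewrite big_cons big_filter; have := sum_mdeg_filter; rewrite mdeg_u;
  lia.
Qed.

Lemma Gcolon_size : (1 < mdeg g)%N ->
  (\sum_(c <- Gcolon) mdeg c < \sum_(c <- G) mdeg c)%N.
Proof.
move=> g2; rewrite big_cons mdeg1 big_map big_filter.
suff: (\sum_(c <- G | c v == 0%N) mdeg (c - u) <= \sum_(c <- G | c != g)
  mdeg c)%N.
  by have := sum_mdeg_filter; lia.
rewrite big_mkcond [X in (_ <= X)%N]big_mkcond leq_sum // => c _.
case: eqP => // cv; case: eqP => [Ec|_]; last exact: mdegB.
by rewrite Ec in cv; lia.
Qed.

End GenericSplitting.

(** Induction on the total degree of the generators. Splitting preserves genericity and both bounds;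
    once only variables remain, the two bounds force their number to be [n - r]. *)
Lemma weakly_regular_generic (k : fieldType) n d r (G : seq 'X_{1..n}) :
  (r <= n)%N -> generic_seq G -> socle_bound G (n - r) ->
    height_bound G (n - r) ->
  weakly_regular (mono_ideal G) (mesym_powers k n d r).
Proof.
move=> rn; have [N] := ubnP (\sum_(c <- G) mdeg c); elim: N G =>
  // N IHN G /ltnSE sizeG.
move=> Ggen Gsoc Ghgt.
have [/hasP[g0 g0G g0deg]|small] :=
  boolP (has (fun c : 'X_{1..n} => 1 < mdeg c)%N G).
  have [v g0v] : exists v, (0 < g0 v)%N.
    case: (pickP (fun z => 0 < g0 z)%N) => [z|w0']; first by exists z.
    have E0 : g0 = 0%MM by apply/mnmP=> i; rewrite mnm0E; have := w0' i; lia.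
    by rewrite E0 mdeg0 in g0deg.
  have exP : exists j, has (fun c : 'X_{1..n} => (c v == j) && (0 < c v)%N) G.
    by exists (g0 v); apply/hasP; exists g0; rewrite ?eqxx.
  have [_ /hasP[g gG /andP[/eqP <- gv]] min_gv] := ex_minnP exP.
  have g_min c : c \in G -> (0 < c v)%N -> (g v <= c v)%N.
    by move=> cG cv; apply: min_gv; apply/hasP; exists c; rewrite ?eqxx.
  have [g2|g1] := ltnP 1 (mdeg g).
    apply: (mono_ideal_split (u := (g - U_(v))%MM)).
      apply: (weakly_regular_mono_eq (divisible_by_Gcolon gG gv g_min)).
      apply: IHN.
      - by apply: leq_trans (Gcolon_size gG gv g2) sizeG.
      - exact: Gcolon_generic.
      - exact: Gcolon_socle.
      - exact: Gcolon_height.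
    apply: (weakly_regular_mono_eq (divisible_by_Gadd _ g v)).
    apply: IHN.
    - by apply: leq_trans (Gadd_size gG gv) sizeG.
    - exact: Gadd_generic.
    - exact: Gadd_socle.
    - exact: Gadd_height.
  (* Here [u] would be [1]; instead the generator [g0], a proper multiple of [x_v], is discarded. *)
  have Eg : g = U_(v)%MM.
    have /mdeg1P[i /eqP Ei] : mdeg g == 1%N.
      have := mdeg_u gv; lia.
    by move: gv; rewrite Ei mnm1E; case: eqP => // ->.
  have gg0 : (g <= g0)%MM by rewrite Eg lep1mP -lt0n.
  have neq : g != g0 by apply/eqP=> E; rewrite -E in g0deg; lia.
  have eqG : divisible_by [seq c <- G | c != g0] =1 divisible_by G.
    apply: divisible_by_eq => c; first by rewrite mem_filter =>
      /andP[_ /mem_divisible_by].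
    move=> cG; have [->|cg0] := eqVneq c g0; last by apply: mem_divisible_by;
      rewrite mem_filter cg0.
    by apply/divisible_byP; exists g; rewrite ?mem_filter ?neq.
  apply: (weakly_regular_mono_eq eqG); apply: IHN.
  - by rewrite big_filter; have := sum_mdeg_filter g0G; lia.
  - move=> a b h; rewrite !mem_filter => /andP[ag aG] /andP[bg bG] ab Eab ah.
    have [c cG cd] := Ggen _ _ _ aG bG ab Eab ah.
    have [Ec|cg] := eqVneq c g0; last by exists c; rewrite // mem_filter cg.
    exists g; first by rewrite mem_filter neq.
    rewrite Ec in cd; move/strictly_dividesP: cd => cd;
      apply/strictly_dividesP=> i gi.
    by have := cd i; have := mnm_lepP gg0 i; lia.
  - by move=> w; rewrite eqG => /Gsoc; under eq_finset do rewrite -eqG.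
  - move=> B BG; apply: Ghgt => c cG; apply: (divisible_by_sub BG).
    by rewrite eqG; apply: mem_divisible_by.
have {}small c : c \in G -> (mdeg c <= 1)%N.
  by move=> cG; rewrite leqNgt; apply/negP=> c1; case/hasP: small; exists c.
have [G0|G0] := boolP (0%MM \in G).
  apply: weakly_regular_unit; first exact: mono_idealP.
  move=> b _; apply/divisible_byP; exists 0%MM => //.
  by apply/mnm_lepP=> i; rewrite mnm0E.
pose B := [set i | U_(i)%MM \in G].
have eqG : divisible_by (variables B) =1 divisible_by G.
  apply: divisible_by_eq => c.
    by case/mapP=> i; rewrite mem_enum inE => iG ->; apply: mem_divisible_by.
  move=> cG; apply: mem_divisible_by.
  have /mdeg1P[i /eqP Ei] : mdeg c == 1%N.
    rewrite eqn_leq small // lt0n mdeg_eq0.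
    by apply: contra G0 => /eqP <-.
  by rewrite Ei map_f // mem_enum inE -Ei.
apply: (weakly_regular_mono_eq eqG); apply: weakly_regular_variables.
have ge : (n - r <= #|B|)%N.
  by apply: Ghgt => c cG; rewrite eqG; apply: mem_divisible_by.
(* The socle bound is applied to the monomial [1], which the variables of [B] take into the
   ideal. *)
have le : (#|B| <= n - r)%N.
  have ndiv0 : ~~ divisible_by G 0%MM.
    apply/divisible_byP=> [[c cG /mnm_lepP c0]]; case/negP: G0.
    suff <- : c = 0%MM by [].
    by apply/mnmP=> i; have := c0 i; rewrite mnm0E; lia.
  apply: leq_trans (Gsoc _ ndiv0); apply/subset_leq_card/subsetP=> i;
    rewrite !inE => iG.
  by rewrite add0m; apply: mem_divisible_by.
suff cB : #|~: B| = r by exact: cB.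
have cB : (#|B| + #|~: B| = n)%N by rewrite cardsC card_ord.
lia.
Qed.

(** * The Scarf complex *)

Section Scarf.
Variables (n t : nat) (m : 'I_t -> 'X_{1..n}).
Implicit Types (s : {set 'I_t}) (u : 'X_{1..n}).

Definition socle_variables u : {set 'I_n} :=
  [set h | divisible_by (codom m) (u + U_(h))%MM].

Lemma lcm_labelE s i : lcm_label m s i = (\max_(j in s) m j i)%N.
Proof.
rewrite /lcm_label (big_morph (fun a : 'X_{1..n} => a i) (id1 := 0%N) (op1 :=
  maxn)) //.
  by move=> a b; rewrite mlcm_apply.
by rewrite mnm0E.
Qed.

Lemma lcm_label_ge s j i : j \in s -> (m j i <= lcm_label m s i)%N.
Proof.
by move=> js;
  rewrite lcm_labelE (leq_bigmax_cond (F := fun j => m j i)).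
Qed.

Lemma lcm_label_le s i e : (forall j, j \in s -> (m j i <= e)%N) ->
  (lcm_label m s i <= e)%N.
Proof. by move=> se; rewrite lcm_labelE; apply/bigmax_leqP. Qed.

Lemma scarfP s : reflect (forall s', lcm_label m s' = lcm_label m s -> s' = s)
  (s \in scarf_complex m).
Proof.
rewrite inE; apply: (iffP forallP) => [h s' E|h s'].
  by apply/eqP; have := h s'; rewrite E eqxx implybF negbK.
by apply/implyP; apply: contraNN => /eqP E; apply/eqP/h.
Qed.

Lemma generic_codom : generic m -> generic_seq (codom m).
Proof.
move=> gen a b h /codomP[i ->] /codomP[j ->] ij Eij ih.
have [|l [_ _ ld]] := gen i j h _ Eij ih; first by apply: contra ij => /eqP->.
by exists (m l); rewrite ?codom_f.
Qed.

(** For each [h] in [A] a generator dividing [u x_h] is chosen: its exponent at [h] is [u h + 1],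
    and its other exponents do not exceed those of [u]. These generators form a Scarf face. *)
Lemma scarf_of_socle u : generic m -> ~~ divisible_by (codom m) u ->
  exists2 s, s \in scarf_complex m & #|s| = #|socle_variables u|.
Proof.
move=> gen nu; set A := socle_variables u.
have ndiv j : ~~ (m j <= u)%MM.
  by apply: contra nu => ju; apply/divisible_byP; exists (m j);
    rewrite ?codom_f.
have [noA|[h0 h0A]] := set_0Vmem A.
  exists set0; last by rewrite noA !cards0.
  apply/scarfP=> s' E; apply/setP=> j; rewrite inE; apply/negP=> js'.
  case/negP: (ndiv j); apply/mnm_lepP=> i.
  have := lcm_label_ge i js'; rewrite E lcm_labelE big_set0; lia.
have [j0 _] : exists j : 'I_t, true.
  by move: h0A; rewrite inE => /divisible_byP[_ /codomP[j _] _]; exists j.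
have /choice[idx idxP] h : exists j, h \in A -> (m j <= u + U_(h))%MM.
  have [hA|_] := boolP (h \in A); last by exists j0.
  by move: (hA); rewrite inE => /divisible_byP[_ /codomP[j ->] jh]; exists j.
have idx_le h i : h \in A -> i != h -> (m (idx h) i <= u i)%N.
  move=> /idxP/mnm_lepP/(_ i) + /negPf ih.
  by rewrite mnmDE mnm1E eq_sym ih addn0.
have idx_eq h : h \in A -> m (idx h) h = (u h).+1.
  move=> hA; have := mnm_lepP (idxP h hA) h; rewrite mnmDE mnm1E eqxx addn1.
  rewrite leq_eqVlt => /orP[/eqP->//|le].
  case/negP: (ndiv (idx h)); apply/mnm_lepP=> i.
  by have [->//|ih] := eqVneq i h; apply: idx_le.
have idx_inj : {in A &, injective idx}.
  move=> h h' hA h'A E; apply/eqP/negPn/negP=> hh'.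
  by have := idx_le h' h h'A hh'; rewrite -E idx_eq // ltnn.
exists [set idx h | h in A]; last exact: card_in_imset.
apply/scarfP=> s' E.
(* A generator [l] in [s'] outside the chosen ones would agree with [idx h] at some [h] in [A]; the
   strict divisor of their lcm given by genericity would divide [u]. *)
have sub : s' \subset [set idx h | h in A].
  apply/subsetP=> l ls'; apply/negPn/negP=> nl.
  have ml i : (m l i <= lcm_label m [set idx h | h in A] i)%N by rewrite -E
    lcm_label_ge.
  have lcm_le i : (lcm_label m [set idx h | h in A] i <= u i + (i \in A))%N.
    apply: lcm_label_le => _ /imsetP[h hA ->].
    have [->|ih] := eqVneq i h; first by rewrite hA idx_eq // addn1.
    by apply: leq_trans (leq_addr _ _); apply: idx_le.
  case: (pickP (fun h => (u h < m l h)%N)) => [h uh|lu]; last first.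
    case/negP: (ndiv l); apply/mnm_lepP=> i; have := lu i; lia.
  have hA : h \in A.
    by apply/negPn/negP=> /negPf hA; have := lcm_le h; have := ml h;
      rewrite hA; lia.
  have Emh : m l h = m (idx h) h.
    by rewrite idx_eq //; have := lcm_le h; have := ml h; rewrite hA; lia.
  have [||q [_ _ /strictly_dividesP qd]] := gen l (idx h) h _ Emh; last 1 first.
  - case/negP: (ndiv q); apply/mnm_lepP=> i; have [->//|qi] := posnP (m q i).
    have := qd i qi; rewrite mlcm_apply; have := ml i; have := lcm_le i.
    have : (m (idx h) i <= lcm_label m [set idx h | h in A] i)%N.
      by apply: lcm_label_ge; apply: imset_f.
    by case: (i \in A); lia.
  - by apply: contra nl => /eqP->; apply: imset_f.
  - by lia.
(* Only [idx h] attains the exponent [u h + 1] at [h], so it cannot be left out. *)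
apply/eqP; rewrite eqEsubset sub; apply/subsetP=> _ /imsetP[h hA ->].
apply/negPn/negP=> ns'.
have : (lcm_label m [set idx h | h in A] h <= u h)%N.
  rewrite -E; apply: lcm_label_le => j js'.
  have /imsetP[h' h'A Ej] := subsetP sub _ js'.
  rewrite Ej; apply: idx_le => //; apply: contra ns' => /eqP->.
  by rewrite -Ej.
by rewrite leqNgt; case/negP; rewrite -idx_eq // lcm_label_ge // imset_f.
Qed.

(** Each [j] in [s] has a variable [h j] in which it alone attains the exponent of the label [b].
    Lowering [b] by one in all these variables gives the required monomial. *)
Lemma socle_of_scarf s : s \in scarf_complex m ->
  exists2 u, ~~ divisible_by (codom m) u & (#|s| <= #|socle_variables u|)%N.
Proof.
move/scarfP=> sS; set b := lcm_label m s.
(* A generator dividing [b] can be added to [s] without changing the label. *)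
have mem_s l : (m l <= b)%MM -> l \in s.
  move=> /mnm_lepP lb; rewrite -(sS (l |: s)) ?setU11 //.
  apply/mnmP=> i; apply/eqP; rewrite eqn_leq; apply/andP; split.
    by apply: lcm_label_le => j /setU1P[->//|js]; apply: lcm_label_ge.
  by apply: lcm_label_le => j js; apply/lcm_label_ge/setU1r.
have sep j : j \in s -> exists i,
      [/\ m j i = b i, (0 < b i)%N & forall l, l \in s -> l != j ->
        (m l i < b i)%N].
  move=> js.
  have [i ij] : exists i, (lcm_label m (s :\ j) i < b i)%N.
    case: (pickP (fun i => (lcm_label m (s :\ j) i < b i)%N)) => [i|eq];
      first by exists i.
    have /setP/(_ j) : s :\ j = s; last by rewrite !inE eqxx js.
    apply: sS; apply/mnmP=> i; apply/eqP; rewrite eqn_leq leqNgt [X in _ &&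
      X]leqNgt eq andbT.
    by rewrite -leqNgt; apply: lcm_label_le => l /setD1P[_ ls];
      apply: lcm_label_ge.
  have lt l : l \in s -> l != j -> (m l i < b i)%N.
    by move=> ls lj; apply: leq_ltn_trans ij; apply: lcm_label_ge;
      rewrite !inE lj.
  exists i; split=> //; last exact: leq_ltn_trans ij.
  apply/eqP; rewrite eqn_leq lcm_label_ge //= leqNgt; apply/negP=> mj.
  have : (b i <= (b i).-1)%N; last by lia.
  apply: lcm_label_le => l ls; have [->|/(lt l ls)] := eqVneq l j; lia.
have [s0|[j0 j0s]] := set_0Vmem s.
  exists 0%MM; last by rewrite s0 cards0.
  apply/divisible_byP=> [[_ /codomP[l ->] /mnm_lepP l0]].
  have : l \in s by apply: mem_s; apply/mnm_lepP=> i; have := l0 i;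
    rewrite mnm0E; lia.
  by rewrite s0 inE.
have [i0 _] := sep j0 j0s.
have /choice[h hP] j : exists i, j \in s ->
    [/\ m j i = b i, (0 < b i)%N & forall l, l \in s -> l != j ->
      (m l i < b i)%N].
  by have [/sep[i]|_] := boolP (j \in s); [exists i | exists i0].
have h_inj : {in s &, injective h}.
  move=> j j' js j's E; apply/eqP/negPn/negP=> jj'.
  have [_ _ /(_ j js jj')] := hP j' j's; have [Ej _ _] := hP j js.
  by rewrite -E Ej ltnn.
pose u := [multinom (b i - (i \in h @: s))%N | i < n].
exists u.
  apply/divisible_byP=> [[_ /codomP[l ->] /mnm_lepP lu]].
  have ls : l \in s by apply: mem_s; apply/mnm_lepP=> i; have := lu i;
    rewrite mnmE; lia.
  have [El b0 _] := hP l ls; have := lu (h l).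
  by rewrite mnmE imset_f // El; lia.
rewrite -(card_in_imset h_inj); apply/subset_leq_card/subsetP=> _
  /imsetP[j js ->].
have [Ej b0 ltj] := hP j js.
rewrite inE; apply/divisible_byP; exists (m j); first exact: codom_f.
apply/mnm_lepP=> i; rewrite mnmDE mnm1E mnmE.
have [<-|hi] := eqVneq (h j) i; first by rewrite imset_f // Ej; lia.
have mji : (m j i <= b i)%N by apply: lcm_label_ge.
have [/imsetP[j' j's Ei]|_] := boolP (i \in h @: s);
  last by rewrite addn0 subn0.
have [_ _ /(_ j js)] := hP j' j's; rewrite -Ei => lt.
have jj' : j != j' by apply: contra hi => /eqP->; rewrite Ei.
by have := lt jj'; lia.
Qed.

Lemma height_boundP (D : nat) :
  (forall Z : {set 'I_n}, {in codom m, forall g,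
    divisible_by (variables (~: Z)) g} ->
    (#|Z| <= D)%N) -> height_bound (codom m) (n - D).
Proof.
move=> VD B BG; have : (#|~: B| <= D)%N by apply: VD; rewrite setCK.
have cB : (#|B| + #|~: B| = n)%N by rewrite cardsC card_ord.
move=> cBD; suff: (n - D <= #|B|)%N by []; lia.
Qed.

(** The factor [z] has the effect of inverting the variables of [Z]. For a monomial [c] of largest
    degree in the other variables with [z c] outside the ideal, each of these variables takes [z c]
    into the ideal. *)
Lemma socle_of_maximal_face (Z : {set 'I_n}) :
  {in codom m, forall g, divisible_by (variables (~: Z)) g} ->
  (forall h, h \notin Z ->
    ~ {in codom m, forall g, divisible_by (variables (~: (h |: Z))) g}) ->
  exists2 u, ~~ divisible_by (codom m) u & (n - #|Z| <= #|socle_variables u|)%N.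
Proof.
move=> ZG Zmax; pose N := (\sum_i mdeg (m i))%N.
have mN i h : (m i h <= N)%N.
  rewrite /N (bigD1 i) //= (mdegE (m i)) (bigD1 h) //=; lia.
pose z := [multinom N * (h \in Z) | h < n]%N.
pose P e := `[< exists c, [/\ mdeg c = e, forall h, h \in Z -> c h = 0%N &
  ~~ divisible_by (codom m) (z + c)%MM] >].
have exP : exists e, P e.
  exists 0%N; apply/asboolP; exists 0%MM; split;
    [exact: mdeg0 | by move=> h; rewrite mnm0E |].
  apply/divisible_byP=> [[g gG /mnm_lepP gz]].
  have /variablesP[h] := ZG g gG; rewrite inE => /negPf hZ gh.
  by have := gz h; rewrite mnmDE mnmE mnm0E hZ; lia.
(* An exponent of [c] above [N] at [h] would force every generator to involve a variable outside
   [h |: Z], against the maximality of [Z]. *)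
have boundP e : P e -> (e <= n * N)%N.
  move/asboolP=> [c [<- cZ nc]]; rewrite mdegE -[n in (n * N)%N]card_ord
    -sum_nat_const.
  apply: leq_sum => h _; have [/cZ->//|hZ] := boolP (h \in Z).
  rewrite leqNgt; apply/negP=> Nch; apply: (Zmax h hZ) => g gG;
    apply/negPn/negP=> /variablesP gh.
  case/negP: nc; apply/divisible_byP; exists g => //; apply/mnm_lepP=> i.
  have [j Ej] := codomP gG; have := mN j i; rewrite -Ej mnmDE mnmE.
  have [Ei|gi] := posnP (g i); first by rewrite Ei.
  have [->|ih] := eqVneq i h; first by lia.
  have -> : i \in Z; last by lia.
  by apply/negPn/negP=> iZ; apply: gh; exists i; rewrite // !inE negb_or ih.
have [e /asboolP[c [Ec cZ nc]] emax] := ex_maxnP exP boundP.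
exists (z + c)%MM => //.
have -> : (n - #|Z| = #|~: Z|)%N.
  have cZ' : (#|Z| + #|~: Z| = n)%N by rewrite cardsC card_ord.
  by rewrite -{1}cZ' addKn.
apply/subset_leq_card/subsetP=> h; rewrite !inE => hZ; apply/negPn/negP=> nh.
have : P e.+1.
  apply/asboolP; exists (c + U_(h))%MM; split.
  - by rewrite mdegD mdeg1 Ec addn1.
  - by move=> i iZ; rewrite mnmDE mnm1E cZ //; case: eqP iZ hZ => // -> ->.
  - by rewrite addmA.
by move/emax; rewrite ltnn.
Qed.

End Scarf.

(** * Polynomial relations and dimension *)

Section Dimension.
Variables (k : fieldType) (n : nat).
Local Notation S := {mpoly k[n]}.
Implicit Types (f g a : S) (y : seq S).

Definition deg_le e f : Prop := {in msupp f, forall b, (mdeg b <= e)%N}.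

Lemma deg_leM e e' f g : deg_le e f -> deg_le e' g -> deg_le (e + e') (f * g).
Proof.
move=> fe ge b /msuppM_le /allpairsP[[b1 b2] /= [/fe b1e /ge b2e ->]].
by rewrite mdegD leq_add.
Qed.

Lemma deg_le_msize f : deg_le (msize f) f.
Proof. by move=> b /msize_mdeg_lt/ltnW. Qed.

Lemma deg_le1 e : deg_le e 1.
Proof. by move=> b; rewrite -mpolyC1 msupp1 inE => /eqP->; rewrite mdeg0. Qed.

Lemma deg_leW e e' f : (e <= e')%N -> deg_le e f -> deg_le e' f.
Proof. by move=> ee' fe b /fe /leq_trans; apply. Qed.

Lemma deg_leX e f i : deg_le e f -> deg_le (e * i) (f ^+ i).
Proof.
move=> fe; elim: i => [|i IHi]; first exact: deg_le1.
by rewrite exprS mulnS; apply: deg_leM.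
Qed.

(* The shape of a nonzero polynomial relation between the entries of y, read
   off its lexicographically lowest term. *)
Fixpoint lowest_form y f : Prop :=
  if y is a :: y' then exists e h g, f = a ^+ e * (h + a * g) /\
    lowest_form y' h
  else exists2 c, c != 0 & f = c%:MP.

(** Along the chain, powers of the current entry cancel and the term [a * g] is absorbed by the next
    ideal, so [h] moves up; a nonzero constant is left at the end. *)
Lemma lowest_form_unit (I : nat -> S -> Prop) y f :
  (forall i, is_ideal (I i)) ->
  (forall i g, (i < size y)%N -> I i g -> I i.+1 g) ->
  (forall i, (i < size y)%N -> I i.+1 y`_i) ->
  (forall i g, (i < size y)%N -> I i (y`_i * g) -> I i g) ->
  lowest_form y f -> I 0%N f -> I (size y) 1.
Proof.
elim: y I f => [|a y IHy] I f idI mono mem nzd /=.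
  case=> c c0 -> Ic; have [_ _ IM] := idI 0%N.
  by have := IM (c^-1)%:MP _ Ic; rewrite -mpolyCM mulVf // mpolyC1.
case=> e [h [g [-> hy]]] I0; apply: (IHy (fun i => I i.+1) h) => //.
- by move=> i g' lti; apply: mono.
- by move=> i lti; apply: (mem i.+1).
- by move=> i g' lti; apply: (nzd i.+1).
have Ihag : I 0%N (h + a * g).
  elim: e I0 => [|e IHe]; first by rewrite expr0 mul1r.
  by rewrite exprS -mulrA => /(nzd 0%N _ isT).
rewrite -(addrK (a * g) h); apply: idealB => //; first exact: mono.
by rewrite mulrC; have [_ _ IM] := idI 1%N; apply/IM/(mem 0%N).
Qed.

Definition monomial_at y (e : seq nat) : S := \prod_(p <- zip y e) p.1 ^+ p.2.

(** The smallest exponent of the first entry is factored out; the terms that attain it form [h] and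
    are treated recursively. *)
Lemma lowest_form_sum y (T : eqType) (r : seq T) (phi : T -> seq nat) (c :
  T -> k) :
  r != [::] -> uniq r -> {in r &, injective phi} ->
  {in r, forall i, size (phi i) = size y} -> {in r, forall i, c i != 0} ->
  lowest_form y (\sum_(i <- r) c i *: monomial_at y (phi i)).
Proof.
elim: y r phi => [|a y IHy] r phi rn0 uniqr phi_inj sz c0 /=.
  case: r rn0 uniqr phi_inj sz c0 => [//|i [|j r]] _ uniqr phi_inj sz c0.
    exists (c i); first by apply: c0; rewrite mem_head.
    rewrite big_seq1 (size0nil (sz i _)) ?mem_head //.
    by rewrite /monomial_at big_nil alg_mpolyC.
  have /phi_inj : phi i = phi j.
    have := sz i; have := sz j; rewrite !inE !eqxx ?orbT =>
      /(_ isT)/size0nil -> /(_ isT)/size0nil -> //.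
  rewrite !inE !eqxx ?orbT => /(_ isT isT) E.
  by move: uniqr; rewrite /= E inE eqxx.
pose hd i := head 0%N (phi i).
have phiE i : i \in r -> phi i = hd i :: behead (phi i).
  by rewrite /hd => /sz; case: (phi i).
have exP : exists e, has (fun i => hd i == e) r.
  by case: r rn0 {uniqr phi_inj sz c0 phiE} => // i r _; exists (hd i);
    rewrite /= eqxx.
have [e /hasP[i0 i0r /eqP Ei0] min_e] := ex_minnP exP.
have {}min_e i : i \in r -> (e <= hd i)%N.
  by move=> ir; apply: min_e; apply/hasP; exists i.
exists e, (\sum_(i <- [seq i <- r | hd i == e]) c i *: monomial_at y
  (behead (phi i))).
exists (\sum_(i <- r | hd i != e) c i *: (a ^+ (hd i - e.+1) * monomial_at y
  (behead (phi i)))).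
split; last first.
  apply: IHy.
  - by rewrite -has_filter; apply/hasP; exists i0; rewrite ?Ei0.
  - exact: filter_uniq.
  - move=> i j; rewrite !mem_filter => /andP[/eqP Ei ir] /andP[/eqP Ej jr] E.
    by apply: phi_inj => //; rewrite phiE // [RHS]phiE // Ei Ej E.
  - by move=> i; rewrite mem_filter => /andP[_ ir]; rewrite size_behead sz.
  - by move=> i; rewrite mem_filter => /andP[_ /c0].
rewrite (bigID (fun i => hd i == e)) /= mulrDr big_filter mulr_sumr;
  congr (_ + _).
  rewrite big_seq_cond [RHS]big_seq_cond; apply: eq_bigr => i /andP[ir /eqP Ei].
  by rewrite [in LHS]phiE // /monomial_at /= big_cons /= Ei scalerAr.
rewrite !mulr_sumr big_seq_cond [RHS]big_seq_cond; apply: eq_bigr =>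
  i /andP[ir Ei].
rewrite [in LHS]phiE // /monomial_at /= big_cons /=.
rewrite -!scalerAr; congr (_ *: _); rewrite !mulrA -exprSr -exprD;
  congr (_ ^+ _ * _).
by have := min_e i ir; lia.
Qed.

Lemma deg_le_monomial_at y (e : seq nat) c L :
  {in y, forall a, deg_le c a} -> {in e, forall i, (i <= L)%N} ->
  deg_le (c * L * size y) (monomial_at y e).
Proof.
elim: y e => [|a y IHy] [|i e] yc eL /=; rewrite /monomial_at /= ?big_nil
  ?big_cons /=;
  try exact: deg_le1.
rewrite mulnS; apply: deg_leM.
  apply: (@deg_leW (c * i)); first by rewrite leq_mul // eL // mem_head.
  by apply/deg_leX/yc; rewrite mem_head.
by apply: IHy => [b yb|j je]; [apply: yc | apply: eL]; rewrite inE ?yb ?je orbT.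
Qed.

Lemma lowest_form_exists y (A : {set 'I_n}) : (n - #|A| < size y)%N ->
  exists2 f, lowest_form y f & mono_ideal (variables A) f.
Proof.
set D := size y; set q := (n - #|A|)%N => ltq.
pose c := (\sum_(a <- y) msize a)%N.
have yc : {in y, forall a, deg_le c a}.
  move=> a ya; apply: deg_leW (@deg_le_msize a).
  by rewrite /c (big_rem a ya) /= leq_addr.
(* There are [L^D] power products with exponents below [L], all of degree below [K], and [K^q]
   monomials free of [A] with exponents below [K]. As [K <= (c D + 1) L] and [(c D + 1)^q < L], the
   former outnumber the latter. *)
pose L := ((c * D).+1 ^ q).+1.
pose K := (c * L * D).+1.
pose T : finType := D.-tuple 'I_L.
pose F : finType := {ffun {i : 'I_n | i \in ~: A} -> 'I_K}.
have cF : #|F| = (K ^ q)%N.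
  rewrite card_ffun card_ord card_sig; congr (_ ^ _)%N.
  rewrite (eq_card (B := ~: A)) // /q.
  have cA : (#|A| + #|~: A| = n)%N by rewrite cardsC card_ord.
  by lia.
have cT : #|T| = (L ^ D)%N by rewrite card_tuple card_ord.
have ltFT : (#|F| < #|T|)%N.
  rewrite cF cT; apply: (@leq_trans (L ^ q.+1)); last by rewrite leq_pexp2l.
  have KL : (K <= (c * D).+1 * L)%N by rewrite /K /L; nia.
  apply: (@leq_ltn_trans (((c * D).+1 * L) ^ q)); first by case: (q) => [|q'];
    rewrite ?expn0 ?leq_exp2r.
  by rewrite expnMn expnS ltn_pmul2r ?expn_gt0.
pose phi (i : 'I_#|T|) : seq nat := [seq nat_of_ord j | j <- enum_val i].
pose beta (th : F) : 'X_{1..n} :=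
  [multinom (if insub i is Some i' then th i' else 0%N) | i < n].
(* The coefficients at monomials free of [A] give more rows than columns, so some nontrivial
   combination [v] of the rows vanishes. *)
pose Mx := \matrix_(i < #|T|, j < #|F|) (monomial_at y (phi i))@_(beta
  (enum_val j)).
have /rowV0Pn[v /sub_kermxP vM /rV0Pn[i0 vi0]] : kermx Mx != 0.
  rewrite kermx_eq0 /row_free; have := rank_leq_col Mx.
  by apply: contraTneq => ->; rewrite -ltnNge.
pose r := [seq i <- enum 'I_#|T| | v 0 i != 0].
have Ef : \sum_(i <- r) v 0 i *: monomial_at y (phi i) =
    \sum_i v 0 i *: monomial_at y (phi i).
  rewrite big_filter big_enum_cond /= [RHS](bigID (fun i => v 0 i != 0)) /=.
  by rewrite [X in _ + X]big1 ?addr0 // => i /negPn/eqP->; rewrite scale0r.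
exists (\sum_(i <- r) v 0 i *: monomial_at y (phi i)).
  apply: lowest_form_sum.
  - by rewrite -has_filter; apply/hasP; exists i0; rewrite ?mem_enum.
  - exact/filter_uniq/enum_uniq.
  - move=> i j _ _ /(inj_map val_inj) E; apply: enum_val_inj; exact: val_inj.
  - by move=> i _; rewrite size_map size_tuple.
  - by move=> i; rewrite mem_filter => /andP[].
move=> b; rewrite Ef => bf; apply/variablesP.
case: (pickP (fun i => (i \in A) && (0 < b i)%N)) => [i /andP[iA bi]|bA];
  first by exists i.
exfalso; move: bf; rewrite mcoeff_msupp raddf_sum /=; apply/negP/negPn.
have degK i : deg_le (c * L * D) (monomial_at y (phi i)).
  apply: deg_le_monomial_at => // _ /mapP[j _ ->]; exact/ltnW.
(* An exponent of at least [K] exceeds the degree of every power product, so these coefficients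
   vanish. *)
have [/forallP bK|] := boolP [forall i, (b i < K)%N]; last first.
  rewrite negb_forall => /existsP[h]; rewrite -leqNgt => Kb.
  rewrite big1 // => i _; rewrite mcoeffZ memN_msupp_eq0 ?mulr0 //.
  apply/negP=> /degK; rewrite mdegE (bigD1 h) //=; move: Kb; rewrite /K; lia.
pose th : F := [ffun i => Ordinal (bK (val i))].
have Eb : beta th = b.
  apply/mnmP=> i; rewrite mnmE; case: insubP => [i' _ <-|];
    first by rewrite ffunE.
  by rewrite inE negbK => iA; have := bA i; rewrite iA /=; lia.
apply/eqP; have /matrixP/(_ 0 (enum_rank th)) := vM; rewrite !mxE => vM0.
by rewrite -[RHS]vM0; apply: eq_bigr => i _; rewrite mcoeffZ !mxE enum_rankK Eb.
Qed.

(** The chain [I] stands for a chain of primes as well as for colon ideals along a regular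
    sequence. *)
Lemma chain_size_le (A : {set 'I_n}) (I : nat -> S -> Prop) y :
  (forall i, is_ideal (I i)) ->
  (forall i g, (i < size y)%N -> I i g -> I i.+1 g) ->
  (forall i, (i < size y)%N -> I i.+1 y`_i) ->
  (forall i g, (i < size y)%N -> I i (y`_i * g) -> I i g) ->
  (forall f, mono_ideal (variables A) f -> I 0%N f) -> ~ I (size y) 1 ->
  (size y <= n - #|A|)%N.
Proof.
move=> idI mono mem nzd IA I1; rewrite leqNgt;
  apply/negP=> /lowest_form_exists[f fy /IA f0].
by apply: I1; apply: lowest_form_unit fy f0.
Qed.

End Dimension.

(** * Top-degree forms *)

Section InitialForms.
Variables (k : fieldType) (n : nat).
Local Notation S := {mpoly k[n]}.
Local Notation part d f := (pihomog mdeg d f).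
Implicit Types (f g h a c : S) (b : 'X_{1..n}) (d e : nat).

Lemma mcoeff_part d f b : (part d f)@_b = if mdeg b == d then f@_b else 0.
Proof.
rewrite pihomogE raddf_sum /= big_mkcond /=.
under eq_bigr => m _ do rewrite mcoeffZ mcoeffX.
have [bf|bf] := boolP (b \in msupp f).
  rewrite (bigD1_seq b) ?msupp_uniq //= eqxx mulr1 big1 ?addr0 // =>
    m /negPf ->.
  by rewrite mulr0; case: ifP.
rewrite big_seq big1 ?memN_msupp_eq0 ?if_same // => m mf.
have [E|_] := eqVneq m b; last by rewrite mulr0; case: ifP.
by rewrite E (negPf bf) in mf.
Qed.

Lemma msize_leP f d : (msize f <= d)%N <-> {in msupp f, forall b,
  (mdeg b < d)%N}.
Proof.
split=> [fd b /msize_mdeg_lt bf|fd]; first exact: leq_trans fd.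
by rewrite msizeE big_seq; apply/bigmax_leqP_seq => b bf _; apply: fd.
Qed.

Lemma msize_leM f g d e : (msize f <= d.+1)%N -> (msize g <= e.+1)%N ->
  (msize (f * g) <= (d + e).+1)%N.
Proof.
move=> /msize_leP fd /msize_leP ge; apply/msize_leP => b /msuppM_le.
by case/allpairsP=> [[b1 b2] /= [/fd b1d /ge b2e ->]]; rewrite mdegD; lia.
Qed.

Lemma msize_leB f g d : (msize f <= d)%N -> (msize g <= d)%N ->
  (msize (f - g) <= d)%N.
Proof.
move=> fd gd; apply: leq_trans (msizeD_le _ _) _.
by rewrite msizeN geq_max fd gd.
Qed.

Lemma part_eq0 f d : (msize f <= d)%N -> part d f = 0.
Proof.
move=> /msize_leP fd; apply/mpolyP=> b; rewrite mcoeff_part mcoeff0.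
case: eqP => // bd; apply: memN_msupp_eq0; apply/negP=> /fd; lia.
Qed.

Lemma msize_part d f : (msize (part d f) <= d.+1)%N.
Proof.
by apply/msize_leP=> b; rewrite mcoeff_msupp mcoeff_part;
  case: (mdeg b =P d) => [->//|_]; rewrite eqxx.
Qed.

Lemma msize_lt_part f d : (msize f <= d.+1)%N -> part d f = 0 ->
  (msize f <= d)%N.
Proof.
move=> /msize_leP fd f0; apply/msize_leP=> b bf.
have := fd b bf; rewrite ltnS leq_eqVlt => /orP[/eqP bd|//].
have /mpolyP/(_ b) := f0; rewrite mcoeff_part mcoeff0 bd eqxx => /eqP.
by rewrite mcoeff_eq0 bf.
Qed.

Lemma partM_homog d e f g : f \is d.-homog ->
  part (d + e) (f * g) = f * part e g.
Proof.
move=> fd; apply/mpolyP=> b.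
rewrite mcoeff_part (mcoeffM f (part e g)) mcoeffM.
have [bd|bd] := eqVneq (mdeg b) (d + e)%N.
  apply: eq_bigr => -[b1 b2] /= /eqP/(congr1 (@mdeg n)); rewrite mdegD =>
    /(etrans (esym bd)) Eb.
  rewrite mcoeff_part; case: eqP => // b2e.
  have [b1d|b1d] := eqVneq (mdeg b1) d; first by move: b2e; lia.
  by rewrite (dhomog_nemf_coeff fd b1d) !mul0r.
symmetry; apply: big1 => -[b1 b2] /= /eqP/(congr1 (@mdeg n));
  rewrite mdegD => Eb.
rewrite mcoeff_part; case: eqP => [b2e|_]; last by rewrite mulr0.
have [b1d|b1d] := eqVneq (mdeg b1) d; last by rewrite
  (dhomog_nemf_coeff fd b1d) mul0r.
by case/eqP: bd; rewrite Eb b1d b2e.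
Qed.

Lemma partM_homog_lt d e f g : f \is d.-homog -> (e < d)%N ->
  part e (f * g) = 0.
Proof.
move=> fd ed; apply/mpolyP=> b; rewrite mcoeff_part mcoeff0; case: eqP => // be.
apply: memN_msupp_eq0; apply/negP=> /msuppM_le
  /allpairsP[[b1 b2] /= [b1f _ Eb]].
have b1d : mdeg b1 = d by apply: (dhomog_mf fd).
by move: be; rewrite Eb mdegD b1d; lia.
Qed.

Lemma partM_top d e f g : (msize f <= d.+1)%N -> (msize g <= e.+1)%N ->
  part (d + e) (f * g) = part d f * part e g.
Proof.
move=> fd ge; rewrite -(partM_homog _ _ (pihomogP mdeg d f)); apply/eqP.
rewrite -subr_eq0 -pihomogB -mulrBl part_eq0 //.
have f' : (msize (f - part d f) <= d)%N.
  apply: msize_lt_part; first by apply: msize_leB fd (msize_part _ _).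
  by rewrite pihomogB pihomog_id subrr.
case: d f' {fd} => [|d] f'; last exact: msize_leM.
by move: f'; rewrite leqn0 msize_poly_eq0 => /eqP->; rewrite mul0r msize0.
Qed.

(** [L] is the ideal of top-degree forms of [I]. The degrees are upper bounds, so a form may be
    zero. *)
Definition initial_ideal (I L : S -> Prop) : Prop :=
  [/\ forall d f, L f -> L (part d f),
      forall d f, (msize f <= d.+1)%N -> I f -> L (part d f) &
      forall d g, L g -> exists f, [/\ I f, (msize f <= d.+1)%N &
        part d f = part d g]].

(** Induction on the degree of [g]: its top form lies in [L], so an element of [I] with the same top
    form can be subtracted. *)
Lemma initial_ideal_nzd I L f e : is_ideal I -> is_ideal L ->
  initial_ideal I L ->
  (msize f <= e.+1)%N -> (forall g, L (part e f * g) -> L g) ->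
  forall g, I (f * g) -> I g.
Proof.
move=> idI idL [gradL inL liftL] fe nzd g.
have [N] := ubnP (msize g); elim: N g => // N IHN g /ltnSE.
case: N IHN => [|N] IHN gN Ifg.
  by move: gN; rewrite leqn0 msize_poly_eq0 => /eqP->; case: idI.
have := inL (e + N)%N _ (msize_leM fe gN) Ifg.
rewrite partM_top // => /nzd /(liftL N)[g' [Ig' g'N]];
  rewrite pihomog_id => Eg'.
rewrite -(subrK g' g); have [_ ID IM] := idI; apply: (ID _ _ _ Ig').
apply: IHN.
  rewrite ltnS; apply: msize_lt_part; first exact: msize_leB.
  by rewrite pihomogB Eg' subrr.
by rewrite mulrBr; apply: idealB => //; apply: IM.
Qed.

(** The point is that a form of [a + c * f] lies in [L + (part e f)] even when top degrees cancel:
    then the top form of [c] lies in [L], and [c] can be lowered modulo [I]. *)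
Lemma initial_ideal_add I L f e : is_ideal I -> is_ideal L ->
  initial_ideal I L ->
  (msize f <= e.+1)%N -> (forall g, L (part e f * g) -> L g) ->
  initial_ideal (ideal_add I f) (ideal_add L (part e f)).
Proof.
move=> idI idL [gradL inL liftL] fe nzd; have [I0 ID IM] := idI;
  have [L0 LD LM] := idL.
have Fe := pihomogP mdeg e f.
have partF c d :
  part d (c * part e f) = (if (e <= d)%N then part (d - e) c else 0) * part e f.
  case: leqP => [ed|de]; last by rewrite mulrC (partM_homog_lt _ Fe) // mul0r.
  by rewrite -{1}(subnKC ed) mulrC (partM_homog _ _ Fe) mulrC.
split.
- move=> d _ [b [c [Lb ->]]]; exists (part d b).
  by exists (if (e <= d)%N then part (d - e) c else 0); rewrite pihomogD partF;
    split; first exact: gradL.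
- move=> d h hd [a [c [Ia Eh]]].
  have [N] := ubnP (msize c); elim: N a c Ia Eh => // N IHN a c Ia Eh /ltnSE cN.
  have [Nd|dN] := leqP (N + e)%N d.+1.
    have cf : (msize (c * f) <= d.+1)%N.
      case: N cN Nd {IHN} => [|N] cN Nd.
        by move: cN; rewrite leqn0 msize_poly_eq0 => /eqP->;
          rewrite mul0r msize0.
      by apply: leq_trans (msize_leM cN fe) _.
    have ad : (msize a <= d.+1)%N by rewrite -(addrK (c * f) a) -Eh msize_leB.
    exists (part d a); have [ed|de] := leqP e d.
      exists (part (d - e) c); split; first exact: inL.
      rewrite Eh pihomogD; congr (_ + _); rewrite -{1}(subnK ed) partM_top //.
      by apply: leq_trans cN _; lia.
    exists 0; split; first exact: inL.
    rewrite Eh pihomogD; congr (_ + _); rewrite mul0r.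
    have N0 : N = 0%N by lia.
    have -> : c = 0 by apply/eqP; rewrite -msize_poly_eq0 -leqn0 -N0.
    by rewrite mul0r pihomog0.
  case: N cN dN IHN => [|N] cN dN IHN.
    move: cN Eh; rewrite leqn0 msize_poly_eq0 => /eqP->.
    rewrite mul0r addr0 => Eha; rewrite Eha in hd *.
    exact: ideal_add_sub (inL _ _ hd Ia).
  have cf := msize_leM cN fe.
  have aN : (msize a <= (N + e).+1)%N.
    by rewrite -(addrK (c * f) a) -Eh msize_leB // (leq_trans hd) //; lia.
  (* In degree [N + e] the sum vanishes, so the forms of [a] and [c * f] there are opposite. *)
  have := inL _ _ aN Ia.
  rewrite -(addrK (c * f) a) -Eh pihomogB partM_top // part_eq0 ?sub0r;
    last first.
    by apply: leq_trans hd _; lia.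
  move/(idealN idL); rewrite opprK mulrC => /nzd /(liftL N)[c' [Ic' c'N]].
  rewrite pihomog_id => Ec'.
  apply: (IHN (a + f * c') (c - c')).
  - by apply: ID => //; apply: IM.
  - by rewrite Eh; ring.
  - rewrite ltnS; apply: msize_lt_part; first exact: msize_leB.
    by rewrite pihomogB Ec' subrr.
- move=> d _ [b [c [Lb ->]]].
  have [b' [Ib' b'd Eb']] := liftL d b Lb.
  exists (b' + (if (e <= d)%N then part (d - e) c else 0) * f).
  have [ed|de] := leqP e d; last first.
    rewrite mul0r addr0; split=> //; first exact: ideal_add_sub.
    by rewrite pihomogD partF leqNgt de /= mul0r addr0.
  have sz : (msize (part (d - e) c * f) <= d.+1)%N.
    by apply: leq_trans (msize_leM (msize_part _ _) fe) _; lia.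
  split; first by exists b', (part (d - e) c).
    by apply: leq_trans (msizeD_le _ _) _; rewrite geq_max b'd.
  rewrite !pihomogD Eb' partF ed; congr (_ + _).
  by rewrite -{1}(subnK ed) partM_top ?msize_part // pihomog_id.
Qed.

Lemma weakly_regular_initial I L (s : seq (nat * S)) :
  is_ideal I -> is_ideal L -> initial_ideal I L ->
  (forall p, p \in s -> (msize p.2 <= p.1.+1)%N) ->
  weakly_regular L [seq part p.1 p.2 | p <- s] ->
    weakly_regular I [seq p.2 | p <- s].
Proof.
elim: s I L => [|[e f] s IHs] I L idI idL IL sz //= [nzd regL].
have fe : (msize f <= e.+1)%N by apply: (sz (e, f)); rewrite mem_head.
split; first exact: initial_ideal_nzd nzd.
apply: IHs regL; try exact: ideal_addP; first exact: initial_ideal_add.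
by move=> p ps; apply: sz; rewrite inE ps orbT.
Qed.

Lemma initial_mono_ideal (G : seq 'X_{1..n}) :
  initial_ideal (mono_ideal G) (mono_ideal G).
Proof.
have partG d f : mono_ideal G f -> mono_ideal G (part d f).
  move=> fG b; rewrite mcoeff_msupp mcoeff_part; case: ifP;
    last by rewrite eqxx.
  by rewrite -mcoeff_msupp => _; apply: fG.
split=> [d f|d f _|d g gG]; [exact: partG | exact: partG |].
by exists (part d g); rewrite msize_part pihomog_id; split=> //; apply: partG.
Qed.

End InitialForms.

(** * Zariski's lemma *)

Section ZariskiLemma.
Variable K : comNzRingType.
Implicit Types (x y z : K) (s : seq K).

Inductive generated (A : comNzRingType) (phi : A -> K) s : K -> Prop :=
| generated_base a : generated phi s (phi a)
| generated_var x : x \in s -> generated phi s x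
| generated_add x y : generated phi s x -> generated phi s y ->
  generated phi s (x + y)
| generated_mul x y : generated phi s x -> generated phi s y ->
  generated phi s (x * y).

(** Multiplying the equation of degree [d] by [c ^+ d.-1] makes it monic in [c * y], where [c] is
    the leading coefficient. *)
Lemma integral_lead_coef (A : idomainType) (phi : {rmorphism A -> K}) (p :
  {poly A}) y :
  (forall a, phi a = 0 -> a = 0) -> p != 0 -> (map_poly phi p).[y] = 0 ->
  integralOver phi (phi (lead_coef p) * y).
Proof.
move=> phi_inj p0 py; set c := lead_coef p; pose d := (size p).-1.
have sp : size p = d.+1 by rewrite /d prednK // size_poly_gt0.
have d0 : (0 < d)%N.
  rewrite lt0n; apply/eqP=> Ed; move: py; rewrite (size1_polyC (p := p)) ?sp
    ?Ed //.
  rewrite map_polyC /= hornerC => /phi_inj p00; case/eqP: p0.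
  by rewrite (size1_polyC (p := p)) ?sp ?Ed // p00.
pose r := \poly_(i < d) (p`_i * c ^+ (d.-1 - i)).
exists ('X^d + r).
  by rewrite monicE lead_coefDl ?lead_coefXn // size_polyXn ltnS size_poly.
have pyE : phi c * y ^+ d + \sum_(i < d) phi p`_i * y ^+ i = 0.
  rewrite -[RHS]py (horner_coef_wide (n := d.+1));
    last by rewrite -sp size_poly.
  rewrite big_ord_recr /= addrC coef_map /c lead_coefE -/d; congr (_ + _).
  by apply: eq_bigr => i _; rewrite coef_map.
apply/rootP; rewrite rmorphD /= map_polyXn hornerD hornerXn.
rewrite (horner_coef_wide (n := d)); last first.
  by apply: leq_trans (size_poly _ _) _; apply: size_poly.
rewrite -[RHS](mulr0 (phi c ^+ d.-1)) -[in RHS]pyE mulrDr mulr_sumr;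
  congr (_ + _).
  by rewrite mulrA -exprSr prednK // exprMn.
apply: eq_bigr => i _; rewrite coef_map coef_poly ltn_ord /= rmorphM rmorphXn
  exprMn.
have -> : phi c ^+ d.-1 = phi c ^+ (d.-1 - i) * phi c ^+ i.
  by rewrite -exprD; congr (_ ^+ _); have := ltn_ord i; lia.
by ring.
Qed.

Lemma generated_integral (A : comNzRingType) (phi : {rmorphism A -> K}) s a z :
  (forall x, x \in s -> integralOver phi (phi a * x)) -> generated phi s z ->
  exists N, integralOver phi (phi a ^+ N * z).
Proof.
move=> int_s; elim=> [b|x xs|x y _ [N xN] _ [N' yN']|x y _ [N xN] _ [N' yN']].
- by exists 0%N; rewrite expr0 mul1r; apply: integral_id.
- by exists 1%N; apply: int_s.
- exists (N + N')%N; rewrite mulrDr; apply: integral_add.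
    rewrite exprD mulrAC mulrC; apply: integral_mul => //.
    by rewrite -rmorphXn; apply: integral_id.
  rewrite exprD -mulrA; apply: integral_mul => //.
  by rewrite -rmorphXn; apply: integral_id.
- exists (N + N')%N; rewrite exprD mulrACA.
  exact: integral_mul.
Qed.

Hypothesis K_field : forall x, x != 0 -> exists y, x * y = 1.

(* If x were transcendental over A, the other generators would be integral over
   A[x][1/f] for some f; but the inverse of 1 + x f is not, as 1 + x f is prime
   to f. *)
Lemma generated_algebraic (A : idomainType) (phi : {rmorphism A -> K}) s :
  (forall a, phi a = 0 -> a = 0) ->
  (forall x, exists2 a, a != 0 & generated phi s (phi a * x)) ->
  forall x, x \in s -> exists2 p : {poly A}, p != 0 & (map_poly phi p).[x] = 0.
Proof.
have [N] := ubnP (size s); elim: N A phi s =>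
  // N IHN A phi s /ltnSE sN phi_inj gen_s x xs.
have [//|noroot] := pselect (exists2 p : {poly A}, p != 0 &
  (map_poly phi p).[x] = 0).
(* If [x] is transcendental, evaluation at [x] is injective, and polynomials over [A] become the new
   base with one generator fewer. *)
pose psi : {rmorphism {poly A} -> K} := horner_eval x \o map_poly phi.
have psi_inj p : psi p = 0 -> p = 0.
  move=> px; have [//|p0] := eqVneq p 0; case: noroot; by exists p.
have psiC a : psi a%:P = phi a by rewrite /= /horner_eval map_polyC hornerC.
have psiX : psi 'X = x by rewrite /= /horner_eval map_polyX hornerX.
clearbody psi.
have gen_psi z : generated phi s z -> generated psi (rem x s) z.
  elim=> [b|y ys|y y' _ + _|y y' _ + _]; last 2 first.
  - exact: generated_add.
  - exact: generated_mul.
  - by rewrite -psiC; apply: generated_base.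
  - have [->|yx] := eqVneq y x; first by rewrite -psiX; apply: generated_base.
    by apply: generated_var; have := perm_mem (perm_to_rem xs) y;
      rewrite ys inE (negPf yx).
have alg_rem y : y \in rem x s -> exists2 p : {poly {poly A}}, p != 0 &
  (map_poly psi p).[y] = 0.
  apply: IHN => //.
    by rewrite size_rem //; case: (s) xs sN => //= z s' _; lia.
  move=> z; have [a a0 ga] := gen_s z; exists a%:P; first by rewrite polyC_eq0.
  by rewrite psiC; apply: gen_psi.
have {alg_rem}/choice[c cP] y : exists c : {poly A},
    c != 0 /\ (y \in rem x s -> integralOver psi (psi c * y)).
  have [yr|_] := boolP (y \in rem x s); last by exists 1; rewrite oner_eq0.
  have [p p0 py] := alg_rem y yr; exists (lead_coef p); rewrite lead_coef_eq0;
    split=> // _.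
  exact: integral_lead_coef.
pose f : {poly A} := \prod_(y <- rem x s) c y.
have f0 : f != 0 by rewrite /f prodf_seq_neq0; apply/allP=> y _; case: (cP y).
have int_f y : y \in rem x s -> integralOver psi (psi f * y).
  move=> yr; rewrite /f (big_rem y yr) /= [c y * _]mulrC rmorphM -mulrA.
  by apply: integral_mul; [apply: integral_id | case: (cP y) => _; apply].
(* Of positive degree, hence nonzero, so its image is invertible in [K]. *)
pose q : {poly A} := 1 + 'X * f.
have size_q : (1 < size q)%N.
  have sXf : (1 < size ('X * f)%R)%N.
    by rewrite mulrC size_mulX // ltnS size_poly_gt0.
  by rewrite /q addrC size_polyDl // size_poly1.
have q0 : q != 0 by rewrite -size_poly_gt0 (ltn_trans _ size_q).
have /K_field[y qy] : psi q != 0 by apply: contraNneq q0 => /psi_inj ->.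
have [b b0 /gen_psi by_gen] := gen_s y.
have [e] := generated_integral int_f by_gen.
set w := (X in integralOver _ X); pose g : {poly A} := f ^+ e * b%:P.
have qw : psi q * w = psi g.
  by rewrite /w /g rmorphM rmorphXn psiC mulrCA [psi q * _]mulrCA qy mulr1.
case=> p p_monic /rootP pw.
pose l := (size p).-1.
have sp : size p = l.+1 by rewrite /l prednK // size_poly_gt0 monic_neq0.
(* Clearing denominators in the integral equation of [w], which is [g/q], shows that [q] divides
   [g ^+ l]. *)
have /psi_inj :
  psi (g ^+ l + q * \sum_(i < l) p`_i * g ^+ i * q ^+ (l.-1 - i)) = 0.
  rewrite -[RHS](mulr0 (psi q ^+ l)) -[in RHS]pw
    (horner_coef_wide (n := l.+1)); last first.
    by rewrite -sp size_poly.
  rewrite big_ord_recr /= coef_map /= -lead_coefE (monicP p_monic)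
    rmorph1 mul1r.
  rewrite rmorphD mulrDr addrC rmorphXn -qw exprMn; congr (_ + _).
  rewrite [RHS]mulr_sumr rmorphM rmorph_sum mulr_sumr; apply: eq_bigr => i _.
  rewrite coef_map /= !rmorphM !rmorphXn -qw exprMn.
  have -> : psi q ^+ l = psi q * psi q ^+ (l.-1 - i) * psi q ^+ i.
    by rewrite -exprS -exprD; congr (_ ^+ _); have := ltn_ord i; lia.
  by ring.
set h := \sum_(i < l) _ => gq.
pose M := (e * l)%N.
(* Modulo [q], ['X * f] is [-1], so [q] divides ['X ^+ M * g ^+ l] and hence the nonzero constant
   [(- 1) ^+ M * b ^+ l]; [r] is the quotient. *)
pose r := - ('X ^+ M * h) - (\sum_(i < M) (q - 1) ^+ (M.-1 - i) * (- 1) ^+ i) *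
  (b ^+ l)%:P.
have qr : ((- 1) ^+ M * b ^+ l)%:P = q * r.
  have Xf : 'X * f = q - 1 by rewrite /q addrC addKr.
  have sub : (q - 1) ^+ M - (- 1) ^+ M = q * \sum_(i < M) (q - 1) ^+
    (M.-1 - i) * (- 1) ^+ i.
    by rewrite subrXX opprK subrK.
  have gE : 'X ^+ M * g ^+ l = (q - 1) ^+ M * (b ^+ l)%:P.
    by rewrite -Xf /g exprMn -exprM -/M rmorphXn exprMn; ring.
  have -> : q * r = - ('X ^+ M * (g ^+ l + q * h)) + 'X ^+ M * g ^+ l -
      q * (\sum_(i < M) (q - 1) ^+ (M.-1 - i) * (- 1) ^+ i) *
        (b ^+ l)%:P by rewrite /r; ring.
  rewrite gq mulr0 oppr0 add0r gE -sub -mulrBl opprB addrC subrK.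
  by rewrite rmorphM rmorphXn rmorphN1.
have r0 : r != 0.
  apply/eqP=> r0; move/eqP: qr; rewrite r0 mulr0 polyC_eq0 mulf_eq0.
  by rewrite signr_eq0 expf_eq0 (negPf b0) andbF.
have := size_polyC_leq1 ((- 1) ^+ M * b ^+ l); rewrite qr size_mul //.
rewrite leqNgt ltn_predRL; case/negP.
by apply: leq_add size_q _; rewrite size_poly_gt0.
Qed.

End ZariskiLemma.

(** * Chains of prime ideals *)

Section PrimeIdeals.
Variable R : comNzRingType.
Implicit Types (I P Q : R -> Prop) (a f g : R).

Definition is_prime I : Prop := ~ I 1 /\ forall f g, I (f * g) -> I f \/ I g.

Lemma idealr_of I : is_ideal I -> ~ I 1 -> exists J : idealr R, forall f,
  f \in J <-> I f.
Proof.
move=> [I0 ID IM] I1; pose p : {pred R} := fun f => `[< I f >].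
have p_closed : idealr_closed p.
  split; first exact/asboolP.
    by apply/asboolP.
  by move=> a f g /asboolP If /asboolP Ig; apply/asboolP/ID => //; apply: IM.
pose J : idealr R := HB.pack p (isIdealr.Build R p p_closed).
by exists J => f; split=> [/asboolP|If]; last exact/asboolP.
Qed.

Lemma prime_idealr_of I : is_ideal I -> is_prime I ->
  exists J : prime_idealr R, forall f, f \in J <-> I f.
Proof.
move=> [I0 ID IM] [I1 IP]; pose p : {pred R} := fun f => `[< I f >].
have p_closed : idealr_closed p.
  split; first exact/asboolP.
    by apply/asboolP.
  by move=> a f g /asboolP If /asboolP Ig; apply/asboolP/ID => //; apply: IM.
have p_prime : prime_idealr_closed p.
  by move=> f g /asboolP /IP[] If; apply/orP; [left | right]; apply/asboolP.
pose J : prime_idealr R := HB.pack p (isIdealr.Build R p p_closed)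
  (isPrimeIdealrClosed.Build R p p_prime).
by exists J => f; split=> [/asboolP|If]; last exact/asboolP.
Qed.

Lemma idealr_is_ideal (I : idealr R) : is_ideal (fun f => f \in I).
Proof.
by split=> [|f g|a f];
  [exact: rpred0 | exact: rpredD | exact: idealMr].
Qed.

Lemma maximal_idealP (P : idealr R) : maximal_ideal P ->
  forall f, f \notin P -> exists a, 1 - a * f \in P.
Proof.
move=> maxP f fP; have idP := idealr_is_ideal P.
have [[b [c [bP E]]]|nu] := pselect (ideal_add (fun g => g \in P) f 1).
  by exists c; rewrite E addrK.
have [Q QP] := idealr_of (ideal_addP f idP) nu.
case/negP: fP; apply: (maxP Q); last exact/QP/ideal_add_gen.
by move=> g gP; apply/QP/ideal_add_sub.
Qed.

Lemma maximal_is_prime (P : idealr R) : maximal_ideal P ->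
  is_prime (fun f => f \in P).
Proof.
move=> maxP; split; first by rewrite idealr1.
move=> f g fg; have [fP|/(maximal_idealP maxP)[a af]] := boolP (f \in P);
  [by left | right].
have -> : g = g * (1 - a * f) + a * (f * g) by ring.
by rewrite rpredD // idealMr.
Qed.

(** By Zorn's lemma there is an ideal maximal among those that contain [I] and avoid [T]; such an
    ideal is prime. *)
Lemma prime_disjoint I (T : R -> Prop) : is_ideal I -> T 1 ->
  (forall a b, T a -> T b -> T (a * b)) -> (forall f, I f -> ~ T f) ->
  exists Q, [/\ is_ideal Q, is_prime Q, forall f, I f -> Q f & forall f, Q f ->
    ~ T f].
Proof.
move=> idI T1 TM IT.
pose good J := [/\ is_ideal J, forall f, I f -> J f & forall f, J f -> ~ T f].
pose X := {J : R -> Prop | good J}.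
have goodI : good I by split.
pose le (J K : X) := `[< forall f, sval J f -> sval K f >].
have [|||[Q [idQ IQ QT]] maxQ] := @classical_sets.ZL_preorder X
  (exist _ I goodI) le.
- by move=> J; apply/asboolP.
- by move=> J K L /asboolP JK /asboolP KL; apply/asboolP=> f /JK/KL.
- move=> A totA; have [[J0 AJ0]|noA] := pselect (exists J, A J); last first.
    exists (exist _ I goodI) => J AJ; case: noA; by exists J.
  pose U f := exists2 J, A J & sval J f.
  have goodU : good U.
    split.
    - split.
      + by exists J0 => //; case: (svalP J0) => [[]].
      + move=> f g [J AJ Jf] [K AK Kg].
        have [/asboolP JK|/asboolP KJ] := totA J K AJ AK.
          by exists K => //; case: (svalP K) => [[_ KD _] _ _]; apply: KD =>
            //; apply: JK.
        by exists J => //; case: (svalP J) => [[_ JD _] _ _]; apply: JD => //;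
          apply: KJ.
      + by move=> a f [J AJ Jf]; exists J => //; case: (svalP J) =>
        [[_ _ JM] _ _]; apply: JM.
    - by move=> f If; exists J0 => //; case: (svalP J0) => _ + _; apply.
    - by move=> f [J _ Jf]; case: (svalP J) => _ _; apply.
  by exists (exist _ U goodU) => J AJ; apply/asboolP=> f Jf; exists J.
exists Q; split=> //; split; first by move/QT.
have [Q0 QD QM] := idQ.
have meetT u : ~ Q u -> exists b c, Q b /\ T (b + c * u).
  move=> nQu; apply: contrapT => noT; apply: nQu.
  have goodQu : good (ideal_add Q u).
    split; [exact: ideal_addP | by move=> f /IQ; apply: ideal_add_sub |].
    by move=> _ [b [c [Qb ->]]] Tbc; apply: noT; exists b, c.
  have leQ : le (exist good Q (And3 idQ IQ QT)) (exist good _ goodQu).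
    by apply/asboolP=> f; apply: ideal_add_sub.
  by have /asboolP := maxQ _ leQ; apply; apply: ideal_add_gen.
move=> u v Quv; apply: contrapT =>
  /not_orP[/meetT[b [c [Qb T1']]] /meetT[b' [c' [Qb' T2]]]].
apply: (QT _ _ (TM _ _ T1' T2)).
have -> : (b + c * u) * (b' + c' * v) = (b' + c' * v) * b + (c * u) * b' + c *
  c' * (u * v) by ring.
by apply: (QD); [apply: (QD)|]; apply: QM.
Qed.

(** The products of powers of [a] with elements outside [P] avoid [I], as [a] can be cancelled; a
    prime avoiding them lies in [P] and misses [a]. *)
Lemma prime_below_nzd I P a : is_ideal I -> is_ideal P -> is_prime P ->
  (forall f, I f -> P f) -> (forall f, I (a * f) -> I f) -> P a ->
  exists Q, [/\ is_ideal Q, is_prime Q, forall f, I f -> Q f,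
    forall f, Q f -> P f & ~ Q a].
Proof.
move=> idI idP [P1 PP] IP aI Pa.
pose T f := exists e t, ~ P t /\ f = a ^+ e * t.
have [||f If [e [t [Pt Ef]]]|Q [idQ primeQ IQ QT]] :=
  prime_disjoint (T := T) idI.
- by exists 0%N, 1; rewrite mulr1.
- move=> _ _ [e [t [Pt ->]]] [e' [t' [Pt' ->]]]; exists (e + e')%N, (t * t').
  by split; [case/PP | rewrite exprD; ring].
- apply: Pt; apply: IP; move: If; rewrite Ef; elim: e {Ef} => [|e IHe].
    by rewrite expr0 mul1r.
  by rewrite exprS -mulrA => /aI.
exists Q; split=> // [f Qf|Qa].
  by apply: contrapT => Pf; apply: (QT f Qf); exists 0%N, f; rewrite mul1r.
by apply: (QT a Qa); exists 1%N, 1; rewrite mulr1.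
Qed.

(** The chain built for the tail starts at a prime containing [I + (a)]; since [a] is a
    nonzerodivisor modulo [I], a smaller prime without [a] fits below it. *)
Lemma regular_prime_chain I P s : is_ideal I -> is_ideal P -> is_prime P ->
  weakly_regular I s -> (forall f, I f -> P f) -> (forall a, a \in s -> P a) ->
  exists Q : nat -> R -> Prop,
    [/\ forall i, is_ideal (Q i) /\ is_prime (Q i), forall f, I f -> Q 0%N f,
        forall i, (i < size s)%N -> (forall f, Q i f -> Q i.+1 f) /\
          ~ (forall f, Q i.+1 f -> Q i f) &
        Q (size s) = P].
Proof.
move=> + idP primeP; elim: s I => [|a s IHs] I idI /=.
  by move=> _ IP _; exists (fun=> P).
move=> [aI regs] IP asP.
have Pa : P a by apply: asP; rewrite mem_head.
have [||Q [Qp IQ Qchain Qs]] := IHs _ (ideal_addP a idI) regs.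
- by case: (idP) => _ PD PM _ [b [c [Ib ->]]]; apply: PD;
    [apply: IP | apply: PM].
- by move=> b bs; apply: asP; rewrite inE bs orbT.
have [idQ0 primeQ0] := Qp 0%N.
have [||Q0 [idQ' primeQ' IQ' Q'Q Q'a]] := prime_below_nzd idI idQ0 primeQ0 _ aI.
- by move=> f If; apply/IQ/ideal_add_sub.
- exact/IQ/ideal_add_gen.
exists (fun i => if i is i'.+1 then Q i' else Q0); split=> //; first by case.
case=> [_|i /Qchain//]; split=> // sub.
by apply: Q'a; apply: sub; apply/IQ/ideal_add_gen.
Qed.

End PrimeIdeals.

(** * Hilbert's basis theorem *)

Section HilbertBasis.
Local Open Scope quotient_scope.

(** Each next index is one where the minimum over the remaining tail is attained. *)
Lemma nondecreasing_subsequence (u : nat -> nat) :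
  exists2 phi : nat -> nat, {homo phi : i j / (i < j)%N} &
    {homo u \o phi : i j / (i <= j)%N}.
Proof.
have /choice[g gP] N : exists j, (N <= j)%N /\ forall l,
  (N <= l -> u j <= u l)%N.
  have exP : exists e, `[< exists2 j, (N <= j)%N & u j = e >].
    by exists (u N); apply/asboolP; exists N.
  have [_ /asboolP[j Nj <-] minj] := ex_minnP exP.
  by exists j; split=> // l Nl; apply: minj; apply/asboolP; exists l.
pose fix phi i := if i is i'.+1 then g (phi i').+1 else g 0%N.
exists phi.
  by apply: homo_ltn => [? ? ?|i /=];
    [apply: ltn_trans | case: (gP (phi i).+1)].
apply: homo_leq => [?|? ? ?|i /=]; [exact: leqnn | exact: leq_trans |].
case: i => [|i] /=; [have [_ le] := gP 0%N | have [_ le] := gP (phi i).+1];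
  apply: le.
  by [].
have [le1 _] := gP (phi i).+1; have [le2 _] := gP (g (phi i).+1).+1; lia.
Qed.

Variables (k : fieldType) (n : nat).

(** Subsequences are extracted for one variable after another, until all exponents are
    nondecreasing. *)
Lemma multinom_wqo (a : nat -> 'X_{1..n}) : exists i j, (i < j)%N /\
  (a i <= a j)%MM.
Proof.
suff [phi phi_lt mono] : exists2 phi : nat -> nat,
  {homo phi : i j / (i < j)%N} &
    forall h : 'I_n, h \in enum 'I_n -> {homo (fun i => a (phi i) h) :
      i j / (i <= j)%N}.
  exists (phi 0%N), (phi 1%N); split; first exact: phi_lt.
  by apply/mnm_lepP=> h; apply: mono; rewrite ?mem_enum.
elim: (enum _) => [|h s [phi phi_lt mono]]; first by exists id.
have [psi psi_lt psi_mono] := nondecreasing_subsequence (fun i => a (phi i) h).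
exists (phi \o psi) => [i j /psi_lt/phi_lt //|h'].
rewrite inE => /orP[/eqP->|/mono h's i j ij]; first exact: psi_mono.
by apply: h's; move: ij; rewrite leq_eqVlt => /orP[/eqP->//|/psi_lt/ltnW].
Qed.

(** Otherwise exponents could be chosen one by one, none divisible by an earlier one, against
    [multinom_wqo]. *)
Lemma dickson (U : 'X_{1..n} -> Prop) : exists2 G : seq 'X_{1..n},
  {in G, forall g, U g} & forall u, U u -> divisible_by G u.
Proof.
apply: contrapT => noG.
have /choice[next nextP] G : exists u, {in G, forall g, U g} -> U u /\
  ~~ divisible_by G u.
  have [GU|] := pselect {in G, forall g, U g}; last by exists 0%MM.
  apply: contrapT => nou; apply: noG; exists G => // u Uu.
  by apply/negPn/negP=> nGu; apply: nou; exists u.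
pose fix L i := if i is i'.+1 then next (L i') :: L i' else [::].
have LU i : {in L i, forall g, U g}.
  elim: i => [//|i IHi] g /=; rewrite inE => /orP[/eqP->|/IHi//].
  by case: (nextP _ IHi).
have memL i j : (i < j)%N -> next (L i) \in L j.
  elim: j => // j IHj; rewrite ltnS leq_eqVlt => /orP[/eqP->|/IHj ij] /=.
    by rewrite mem_head.
  by rewrite inE ij orbT.
have [i [j [/memL ij le]]] := multinom_wqo (fun i => next (L i)).
have [_ /negP] := nextP _ (LU j); apply; apply/divisible_byP.
by exists (next (L i)).
Qed.

(** By Dickson's lemma finitely many leading monomials of [I] divide all the others; lifts of these
    generate [I], by division with induction on the leading monomial. *)
Lemma hilbert_basis (I : {mpoly k[n]} -> Prop) : is_ideal I ->
  exists s, forall f, I f <-> ideal_adds (fun g => g = 0) s f.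
Proof.
move=> idI; have [I0 ID IM] := idI.
have id0 : is_ideal (fun g : {mpoly k[n]} => g = 0).
  by split=> // [f g -> ->|a f ->]; rewrite ?addr0 ?mulr0.
have [G GI Gdiv] := dickson (fun u => exists f, [/\ I f, f != 0 & mlead f = u]).
have /choice[lift liftP] g : exists f, g \in G ->
  [/\ I f, f != 0 & mlead f = g].
  by have [/GI[f fP]|_] := boolP (g \in G); [exists f | exists 0].
exists (map lift G) => f; split; last first.
  apply: ideal_adds_le => // [g ->//|_ /mapP[g gG ->]].
  by case: (liftP g gG).
have idG := ideal_addsP (map lift G) id0; have [_ JD JM] := idG.
move Eu: (mlead f) => u; elim/(@ltmwf n): u f Eu => u IHu f Eu If.
have [->|f0] := eqVneq f 0; first by case: idG.
have /divisible_byP[g gG gu] : divisible_by G u by apply: Gdiv; exists f.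
have [Ig g0 Eg] := liftP g gG.
pose c := mleadc f / mleadc (lift g).
pose f' := c *: ('X_[u - g] * lift g).
have X0 : 'X_[u - g] != 0 :> {mpoly k[n]} by rewrite -msize_poly_eq0 msizeX.
have lead_f' : mlead ('X_[u - g] * lift g) = u.
  by rewrite mleadM // mleadXm Eg submK.
have coef_f' : f'@_u = mleadc f.
  rewrite mcoeffZ -[X in _@_X]lead_f' mleadM // mleadcM mleadXm mcoeffX
    eqxx mul1r.
  by rewrite divfK // mleadc_eq0.
have Jf' : ideal_adds (fun g => g = 0) (map lift G) f'.
  by rewrite /f' scalerAl; apply/JM/ideal_adds_gen => //; apply: map_f.
have If' : I f' by rewrite /f' scalerAl; apply: IM.
rewrite -(subrK f' f); apply: (JD _ _ _ Jf').
have [->|ff'] := eqVneq (f - f') 0; first by case: idG.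
apply: (IHu (mlead (f - f'))) => //; last exact: idealB.
rewrite Order.POrderTheory.lt_neqAle; apply/andP; split.
  apply/eqP=> E; have := mlead_supp ff'.
  by rewrite mcoeff_msupp E mcoeffB coef_f' -Eu subrr eqxx.
apply: Order.POrderTheory.le_trans (mleadB_le _ _) _.
rewrite Order.JoinTheory.leUx Eu Order.POrderTheory.lexx /=.
by apply: Order.POrderTheory.le_trans (mleadZ_le _ _) _; rewrite lead_f'.
Qed.

Lemma noetherian_quotient (M : idealr {mpoly k[n]}) : noetherian {ideal_quot M}.
Proof.
move=> I; pose J (f : {mpoly k[n]}) := \pi_{ideal_quot M} f \in I.
have idJ : is_ideal J.
  split=> [|f g|a f]; rewrite /J ?rmorph0 ?rmorphD ?rmorphM.
  - exact: rpred0.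
  - exact: rpredD.
  - exact: idealMr.
have [s sJ] := hilbert_basis idJ.
have surj (y : {ideal_quot M}) : exists f, \pi_{ideal_quot M} f = y.
  by exists (repr y); rewrite reprK.
pose x (i : 'I_(size s)) := \pi_{ideal_quot M} s`_i.
exists (size s), x => f; rewrite in_gen_ideal_codom.
have -> : codom x = map \pi_{ideal_quot M} s.
  apply: (@eq_from_nth _ 0); rewrite size_codom card_ord ?size_map // => i lti.
  rewrite (nth_map 0) // /codom /image_mem (nth_map (Ordinal lti))
    ?size_enum_ord //.
  by rewrite /x nth_enum_ord.
have [g <-] := surj f; rewrite -/(J g) (ideal_adds_preim surj); split.
  move/sJ; have id0 : is_ideal (fun f : {mpoly k[n]} =>
    \pi_{ideal_quot M} f = 0).
    split=> [|f1 f2 E1 E2|a f1 E1]; first exact: rmorph0.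
      by rewrite rmorphD /= E1 E2 addr0.
    by rewrite rmorphM /= E1 mulr0.
  apply: ideal_adds_le; first exact: ideal_addsP.
    by move=> _ ->; case: (ideal_addsP s id0).
  by move=> a; apply: ideal_adds_gen.
apply: (ideal_adds_le idJ) => [f0 E0|a sa]; first by rewrite /J E0 rpred0.
apply/sJ/ideal_adds_gen => //.
by split=> // [f1 f2 -> ->|b f1 ->]; rewrite ?addr0 ?mulr0.
Qed.

End HilbertBasis.

(** * Quotients of polynomial rings *)

Section Quotient.
Local Open Scope quotient_scope.
Variables (R : comNzRingType) (M : idealr R).
Local Notation Q := {ideal_quot M}.
Local Notation pi := (\pi_Q : R -> Q).

Lemma pi_eq0 f : pi f = 0 <-> f \in M.
Proof.
rewrite -[X in X \in _](subr0 f) Quotient.idealrBE -(rmorph0 \pi_Q).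
by split=> /eqP.
Qed.

Lemma pi_surj (y : Q) : exists f, pi f = y.
Proof. by exists (repr y); rewrite reprK. Qed.

Variable I : R -> Prop.
Hypothesis idI : is_ideal I.
Hypothesis MI : forall f, f \in M -> I f.

(** The image of [I] in the quotient; the choice of representative does not matter because [I]
    contains [M]. *)
Definition image_ideal (y : Q) : Prop := I (repr y).

Lemma image_idealE f : image_ideal (pi f) <-> I f.
Proof.
rewrite /image_ideal; have /MI MIf : repr (pi f) - f \in M.
  by apply/pi_eq0; rewrite rmorphB /= reprK subrr.
have [_ ID IM] := idI; split=> If.
  by rewrite -[f](subKr (repr (pi f))); apply: idealB.
by rewrite -(subrK f (repr (pi f))); apply: ID.
Qed.

Lemma image_ideal_ideal : is_ideal image_ideal.
Proof.
have [I0 ID IM] := idI; split; first by rewrite -(rmorph0 \pi_Q) image_idealE.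
- move=> y z; have [f <-] := pi_surj y; have [g <-] := pi_surj z.
  by rewrite -rmorphD !image_idealE; apply: ID.
- move=> a y; have [f <-] := pi_surj y; have [b <-] := pi_surj a.
  by rewrite -rmorphM !image_idealE; apply: IM.
Qed.

Lemma image_ideal_prime : is_prime I -> is_prime image_ideal.
Proof.
case=> I1 IP; split; first by rewrite -(rmorph1 \pi_Q) image_idealE.
move=> y z; have [f <-] := pi_surj y; have [g <-] := pi_surj z.
by rewrite -rmorphM !image_idealE; apply: IP.
Qed.

End Quotient.

(** * Ideals generated by variables, and top forms of polynomial expressions *)

Section VariableIdeals.
Variables (k : fieldType) (n : nat).
Implicit Types (B : {set 'I_n}) (f g : {mpoly k[n]}).

(** The parts of [f] and [g] free of [B] multiply to a nonzero polynomial whose leading monomial is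
    again free of [B]. *)
Lemma mono_variables_prime B : is_prime (mono_ideal (k := k) (variables B)).
Proof.
have idB := mono_idealP k (variables B).
split.
  move/(_ 0%MM); rewrite -mpolyC1 msupp1 mem_head => /(_ isT)/variablesP[i _].
  by rewrite mnm0E.
pose free f := \sum_(b <- msupp f | ~~ divisible_by (variables B) b) f@_b *:
  'X_[b].
have freeP f : mono_ideal (variables B) (f - free f).
  rewrite {1}[f]mpolyE (bigID (divisible_by (variables B))) /= addrK.
  apply: ideal_sum => // b bB; rewrite -mul_mpolyC; case: idB => _ _; apply.
  exact/mono_idealX.
have free_supp f b : b \in msupp (free f) -> ~~ divisible_by (variables B) b.
  move=> /msupp_sum_le/flattenP[s /mapP[c + ->]].
  rewrite mem_filter => /andP[cB _] /msuppZ_le; rewrite msuppX inE => /eqP->.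
  exact: cB.
move=> f g fgB; apply: contrapT => /not_orP[fB gB].
have f0 : free f != 0 by apply/eqP=> E; apply: fB; have := freeP f;
  rewrite E subr0.
have g0 : free g != 0 by apply/eqP=> E; apply: gB; have := freeP g;
  rewrite E subr0.
have fg0 : free f * free g != 0 by rewrite mulf_neq0.
have [_ ID IM] := idB.
have prodB : mono_ideal (variables B) (free f * free g).
  have -> : free f * free g = f * g - (g * (f - free f) + free f *
    (g - free g)) by ring.
  apply: (idealB idB fgB); apply: (ID); apply: (IM); exact: freeP.
have lead := mlead_supp fg0.
have /variablesP[i iB] := prodB _ lead.
have /allpairsP[[b1 b2] /= [/free_supp b1B /free_supp b2B ->]] :=
  msuppM_le lead.
rewrite mnmDE addn_gt0 => /orP[] bi.
  by case/negP: b1B; apply/variablesP; exists i.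
by case/negP: b2B; apply/variablesP; exists i.
Qed.

Lemma mono_variables_le (I : {mpoly k[n]} -> Prop) B : is_ideal I ->
  (forall i, i \in B -> I 'X_i) -> forall f, mono_ideal (variables B) f -> I f.
Proof.
move=> idI BI f fB; have [_ _ IM] := idI; rewrite [f]mpolyE big_seq.
apply: ideal_sum => // b /fB/variablesP[i iB bi].
rewrite -mul_mpolyC -[b](submK (m := U_(i)%MM)) ?lep1mP -?lt0n // mpolyXD mulrA.
exact/IM/BI.
Qed.

Lemma mono_variables_setT f : mono_ideal (variables [set: 'I_n]) f <->
  f@_0%MM = 0.
Proof.
split=> [fT|f0 b bf].
  apply: memN_msupp_eq0; apply/negP=> /fT/variablesP[i _]; by rewrite mnm0E.
apply/variablesP; case: (pickP (fun i => 0 < b i)%N) => [i bi|b0];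
  first by exists i; rewrite ?inE.
have E : b = 0%MM by apply/mnmP=> i; rewrite mnm0E; have := b0 i; lia.
by move: bf; rewrite mcoeff_msupp E f0 eqxx.
Qed.

Lemma msize_dhomog d f : f \is d.-homog -> (msize f <= d.+1)%N.
Proof. by move/dhomogP=> fd; apply/msize_leP => b /fd ->. Qed.

Lemma horner_top_form (p : {poly k}) (e : {mpoly k[n]}) j : p \is monic ->
  (0 < j)%N ->
  e \is j.-homog ->
  let g := (map_poly (@mpolyC n k) p).[e] in let d := (size p).-1 in
  (msize g <= (j * d).+1)%N /\ pihomog mdeg (j * d) g = e ^+ d.
Proof.
move=> p_monic j0 ej g d.
have sp : size p = d.+1 by rewrite /d prednK // size_poly_gt0 monic_neq0.
have hom i : (p`_i)%:MP * e ^+ i \is (j * i).-homog.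
  by rewrite mul_mpolyC; apply/dhomogZ/dhomogMn.
have Eg : g = \sum_(i < d) (p`_i)%:MP * e ^+ i + e ^+ d.
  rewrite /g (horner_coef_wide (n := d.+1)); last by rewrite -sp size_poly.
  rewrite big_ord_recr /= coef_map /= -{3}/d -lead_coefE (monicP p_monic)
    mpolyC1 mul1r.
  by congr (_ + _); apply: eq_bigr => i _; rewrite coef_map.
split.
  rewrite Eg; apply: leq_trans (msizeD_le _ _) _; rewrite geq_max;
    apply/andP; split.
    apply: leq_trans (msize_sum _ _ _) _; apply/bigmax_leqP=> i _.
    apply: leq_trans (msize_dhomog (hom i)) _;
      rewrite ltnS leq_mul2l ltnW ?orbT //.
  by apply: msize_dhomog; apply: dhomogMn.
rewrite Eg pihomogD raddf_sum big1 ?add0r => [|i _ /=]; last first.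
  rewrite (pihomog_ne0 (d := j * i)) ?hom // eqn_pmul2l // neq_ltn ltn_ord //.
by rewrite pihomog_dE //; apply: dhomogMn.
Qed.

End VariableIdeals.

(** * Algebraic elements modulo a maximal ideal *)

Section AlgebraicModMaximal.
Local Open Scope quotient_scope.
Variables (k : fieldType) (n : nat) (M : idealr {mpoly k[n]}).
Local Notation Q := {ideal_quot M}.

(** The residue field is finitely generated as an algebra over [k], so by Zariski's lemma the image
    of [e] is a root of a polynomial over [k], made monic by scaling. *)
Lemma algebraic_mod_maximal (P : idealr Q) (e : {mpoly k[n]}) :
  maximal_ideal P ->
  exists2 p : {poly k}, p \is monic &
    \pi_Q (map_poly (@mpolyC n k) p).[e] \in P.
Proof.
move=> maxP; pose K := {ideal_quot P}.
pose psi : {rmorphism {mpoly k[n]} -> K} := \pi_K \o \pi_Q.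
pose phi : {rmorphism k -> K} := psi \o @mpolyC n k.
have psi_surj y : exists f, psi f = y.
  have [x <-] := pi_surj y; have [f <-] := pi_surj x; by exists f.
have K_field (x : K) : x != 0 -> exists y, x * y = 1.
  have [f <-] := pi_surj x => f0.
  have [|a /pi_eq0] := maximal_idealP maxP (f := f).
    by apply: contra f0 => /pi_eq0 ->.
  rewrite rmorphB rmorph1 rmorphM => /eqP; rewrite subr_eq0 => /eqP E.
  by exists (\pi_K a); rewrite mulrC E.
have phi_inj a : phi a = 0 -> a = 0.
  move=> a0; have [//|a_neq0] := eqVneq a 0; case/eqP: (oner_neq0 K).
  by rewrite -(rmorph1 phi) -(mulfV a_neq0) rmorphM a0 mul0r.
(* The image of [e] joins the list because [generated_algebraic] speaks of listed generators
   only. *)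
pose s := psi e :: [seq psi 'X_i | i <- enum 'I_n].
have gen_psi f : generated phi s (psi f).
  have gen1 : generated phi s 1 by rewrite -(rmorph1 phi);
    apply: generated_base.
  have gen0 : generated phi s 0 by rewrite -(rmorph0 phi);
    apply: generated_base.
  rewrite [f]mpolyE rmorph_sum; elim/big_ind: _ => // [x y xg yg|b _];
    first exact: generated_add.
  rewrite -mul_mpolyC rmorphM; apply: generated_mul;
    first exact: generated_base.
  rewrite mpolyXE_id rmorph_prod; elim/big_ind: _ => // [x y xg yg|i _];
    first exact: generated_mul.
  rewrite rmorphXn; elim: (b i) => [|j IHj]; first by rewrite expr0.
  rewrite exprS; apply: generated_mul => //; apply: generated_var.
  by rewrite inE; apply/orP; right; apply/mapP; exists i; rewrite ?mem_enum.
have [||p p0 pe] := generated_algebraic K_field phi_inj _ (x := psi e) (s := s).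
- move=> x; exists 1; first exact: oner_neq0.
  by rewrite rmorph1 mul1r; have [f <-] := psi_surj x.
- by rewrite mem_head.
exists ((lead_coef p)^-1 *: p).
  by rewrite monicE lead_coefZ mulVf ?lead_coef_eq0.
apply/pi_eq0; rewrite map_polyZ hornerZ !rmorphM /=.
suff -> : \pi_K (\pi_Q (map_poly (@mpolyC n k) p).[e]) = 0 by rewrite mulr0.
rewrite -[RHS]pe -[LHS]/(psi _) -horner_map -map_poly_comp //.
Qed.

End AlgebraicModMaximal.

(** * Depth and codimension in the quotient by a monomial ideal *)

Section MonomialQuotient.
Local Open Scope quotient_scope.
Variables (k : fieldType) (n t : nat) (M : idealr {mpoly k[n]}) (m : 'I_t ->
  'X_{1..n}).
Hypothesis m_min : minimal_monomial_generators M m.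
Local Notation S := {mpoly k[n]}.
Local Notation Q := {ideal_quot M}.
Local Notation G := (codom m).
Implicit Types (f : S) (Z : {set 'I_n}).

Lemma mem_monomial f : f \in M <-> mono_ideal G f.
Proof. by rewrite -mono_ideal_gen; case: m_min => + _; apply. Qed.

Lemma nondivisible0 : ~~ divisible_by G 0%MM.
Proof.
apply/negP=> G0; have /idP := idealr1 M; apply; apply/mem_monomial.
by rewrite -mpolyX0; apply/mono_idealX.
Qed.

(** A power of the product over [Z] lies in [M] exactly when some generator involves only variables
    of [Z]; so faces correspond to the primes generated by variables that contain [M]. *)
Lemma radical_complexP Z : reflect {in G, forall g,
  divisible_by (variables (~: Z)) g}
  (Z \in radical_complex M).
Proof.
have XZ : \prod_(i in Z) 'X_i = 'X_[mesym1 Z] :> S.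
  rewrite mpolyXE_id [RHS](bigID (fun i => i \in Z)) /= [X in _ * X]big1
    ?mulr1; last first.
    by move=> i /negPf iZ; rewrite mnmE iZ expr0.
  by apply: eq_bigr => i iZ; rewrite mnmE iZ expr1.
rewrite inE XZ; apply: (iffP (asboolP _)) => [nrad g gG|ZG [N]].
  apply/negPn/negP=> /variablesP gZ; apply: nrad; exists (mdeg g).
  rewrite mpolyXn; apply/mem_monomial/mono_idealX/divisible_byP; exists g => //.
  apply/mnm_lepP=> i; rewrite mulmnE mnmE.
  have [->|gi] := posnP (g i); first by [].
  have [_|iZ] := boolP (i \in Z); first by rewrite mul1n mdegE (bigD1 i) //=
    leq_addr.
  by case: gZ; exists i; rewrite ?inE.
rewrite mpolyXn => /mem_monomial/mono_idealX/divisible_byP[g gG /mnm_lepP gZ].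
have /variablesP[i] := ZG g gG; rewrite inE => /negPf iZ gi.
by have := gZ i; rewrite mulmnE mnmE iZ mul0n; lia.
Qed.

(** This is [dim V(M) + 1], the Krull dimension of the quotient. *)
Definition face_bound : nat := \max_(Z in radical_complex M) #|Z|.

Lemma face_bound_le Z : Z \in radical_complex M -> (#|Z| <= face_bound)%N.
Proof. by move=> ZV; apply: (leq_bigmax_cond (F := fun Z => #|Z|)). Qed.

Lemma maximal_face : exists2 Z, Z \in radical_complex M & #|Z| = face_bound.
Proof.
have V0 : set0 \in radical_complex M.
  apply/radical_complexP=> g gG; rewrite setC0; apply/variablesP.
  case: (pickP (fun i => 0 < g i)%N) => [i gi|g0]; first by exists i;
    rewrite ?inE.
  case/negP: nondivisible0; apply/divisible_byP; exists g => //.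
  by apply/mnm_lepP=> i; have := g0 i; rewrite mnm0E; lia.
have [|Z ZV E] := @eq_bigmax_cond _ (mem (radical_complex M)) (fun Z => #|Z|).
  by rewrite (cardD1 set0) V0.
by exists Z.
Qed.

(** The variables outside the lowest prime form a face, as each generator of [M] has a variable in
    that prime. Elements of each prime missing from the one before feed [chain_size_le]. *)
Lemma prime_chain_le (Qc : nat -> Q -> Prop) e :
  (forall i, is_ideal (Qc i) /\ is_prime (Qc i)) ->
  (forall i, (i < e)%N -> (forall y, Qc i y -> Qc i.+1 y) /\
    ~ (forall y, Qc i.+1 y -> Qc i y)) ->
  (e <= face_bound)%N.
Proof.
move=> Qc_prime Qc_lt; pose I i f := Qc i (\pi_Q f).
have idI i : is_ideal (I i).
  have [[Q0 QD QM] _] := Qc_prime i.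
  by rewrite /I; split=> [|f g|a f]; rewrite ?rmorph0 ?rmorphD ?rmorphM //;
    [apply: QD | apply: QM].
have [_ [I1 IP]] := Qc_prime 0%N.
have /choice[y yP] i : exists f, (i < e)%N -> I i.+1 f /\ ~ I i f.
  have [lti|_] := boolP (i < e)%N; last by exists 0.
  have [_ nsub] := Qc_lt i lti; apply: contrapT => noy; apply: nsub => x.
  have [f <-] := pi_surj x => If; apply: contrapT => nIf; apply: noy.
  by exists f.
pose A := [set h | `[< I 0%N ('X_h : S) >]].
have AV : ~: A \in radical_complex M.
  apply/radical_complexP=> g gG; rewrite setCK; apply/variablesP.
  have : I 0%N 'X_[g].
    have /pi_eq0 E :
      'X_[g] \in M by apply/mem_monomial/mono_idealX/mem_divisible_by.
    by rewrite /I E; case: (Qc_prime 0%N) => [[]].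
  rewrite mpolyXE_id; apply: contraPP => nA.
  have nI i : (0 < g i)%N -> ~ I 0%N ('X_i : S).
    by move=> gi Ii; apply: nA; exists i => //; rewrite inE; apply/asboolP.
  elim/big_ind: _ => [|f f' nf nf'|i _].
  - by rewrite /I rmorph1.
  - by rewrite /I rmorphM => /IP[].
  case: (posnP (g i)) => [->|/nI {}nI]; first by rewrite expr0 /I rmorph1.
  elim: (g i) => [|j IHj]; first by rewrite expr0 /I rmorph1.
  by rewrite exprS /I rmorphM => /IP[].
apply: leq_trans (face_bound_le AV).
have -> : #|~: A| = (n - #|A|)%N.
  have cA : (#|A| + #|~: A| = n)%N by rewrite cardsC card_ord.
  lia.
have ys : size (mkseq y e) = e by rewrite size_mkseq.
rewrite -{1}ys; apply: (chain_size_le (I := I)); rewrite ?ys //.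
- by move=> i g lti; rewrite /I; apply: (Qc_lt i lti).1.
- by move=> i lti; rewrite nth_mkseq //; case: (yP i lti).
- move=> i g lti; rewrite nth_mkseq // /I rmorphM => /(Qc_prime i).2.2[|//].
  by case: (yP i lti).
- by apply: mono_variables_le => // i; rewrite inE => /asboolP.
- by rewrite /I rmorph1; case: (Qc_prime e) => _ [].
Qed.

Lemma codim_le (P : idealr Q) d :
  (exists C : 'I_d.+1 -> prime_idealr Q, (forall i j : 'I_d.+1, (i < j)%N ->
       {subset C i <= C j} /\ ~ {subset C j <= C i}) /\ C ord_max =i P) ->
  (d <= face_bound)%N.
Proof.
case=> C [C_lt _]; apply: (prime_chain_le (Qc := fun i y => y \in C (inord i))).
  move=> i; split; first exact: idealr_is_ideal.
  by split; [rewrite idealr1 | move=> f g; rewrite prime_idealrM => /orP].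
move=> i lti; have [|sub nsub] := C_lt (inord i) (inord i.+1).
  by rewrite !inordK // ltnW.
by split=> // nsub'; apply: nsub => y /nsub'.
Qed.

Lemma regular_chain (P : idealr Q) d (x : 'I_d -> Q) :
  is_prime (fun y => y \in P) ->
  regular_sequence x -> (forall i, x i \in P) ->
  exists C : nat -> Q -> Prop, [/\ forall i, is_ideal (C i) /\ is_prime (C i),
    forall i, (i < d)%N -> (forall y, C i y -> C i.+1 y) /\
      ~ (forall y, C i.+1 y -> C i y) &
    C d = (fun y => y \in P)].
Proof.
move=> primeP /regular_sequenceP[_ regx] xP.
have sz : size (codom x) = d by rewrite size_codom card_ord.
have [|||C [Cp _ C_lt Cd]] := regular_prime_chain _ (idealr_is_ideal P)
  primeP regx.
- by split=> // [f g -> ->|a f ->]; rewrite ?addr0 ?mulr0.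
- by move=> _ ->; apply: rpred0.
- by move=> _ /codomP[i ->].
by exists C; rewrite sz in C_lt Cd.
Qed.

Lemma depth_le (P : idealr Q) d : is_prime (fun y => y \in P) ->
  (exists x : 'I_d -> Q, regular_sequence x /\ forall i, x i \in P) ->
    (d <= face_bound)%N.
Proof.
move=> primeP [x [regx xP]]; have [C [Cp C_lt _]] :=
  regular_chain primeP regx xP.
exact: prime_chain_le C_lt.
Qed.

Lemma codim_depth_of_regular (P : idealr Q) (x : 'I_face_bound -> Q) :
  is_prime (fun y => y \in P) -> regular_sequence x -> (forall i, x i \in P) ->
  has_depth P face_bound /\ has_codim P face_bound.
Proof.
move=> primeP regx xP; split; split.
- by exists x.
- by move=> e; apply: depth_le.
- have [C [Cp C_lt CP]] := regular_chain primeP regx xP.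
  have /choice[J JP] i : exists J : prime_idealr Q, forall y, y \in J <-> C i y.
    by apply: prime_idealr_of; case: (Cp i).
  have C_le i j y : (i <= j)%N -> (j <= face_bound)%N -> C i y -> C j y.
    elim: j => [|j IHj]; first by rewrite leqn0 => /eqP->.
    rewrite leq_eqVlt => /orP[/eqP->//|ij] jd /(IHj ij (ltnW jd)).
    exact: (C_lt j jd).1.
  exists (fun i => J i); split=> [i j ij|y].
    have jd : (j <= face_bound)%N by rewrite -ltnS.
    split=> [y /JP Cy|sub]; first by apply/JP; apply: C_le Cy;
      first exact: ltnW.
    have [_] := C_lt i (leq_trans ij jd); apply=> y Cy.
    by apply/JP/sub/JP; apply: C_le Cy.
  by apply/idP/idP => [/JP|yP]; rewrite ?CP //; apply/JP; rewrite CP.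
- by move=> e; apply: codim_le.
Qed.

(** The sequence consists of monic polynomials in the elementary symmetric polynomials, whose top
    forms are powers of these. The exponents depend on [P], so the hypothesis covers all [d]. *)
Lemma regular_in_maximal (P : idealr Q) :
  (forall d, weakly_regular (mono_ideal (k := k) G)
    (mesym_powers k n d face_bound)) ->
  maximal_ideal P ->
  exists x : 'I_face_bound -> Q, regular_sequence x /\ forall i, x i \in P.
Proof.
move=> reg maxP.
have /choice[p pP] j : exists p : {poly k}, p \is monic /\
    \pi_Q (map_poly (@mpolyC n k) p).[mesym n k j] \in P.
  by have [p p1 p2] := algebraic_mod_maximal (mesym n k j) maxP; exists p.
pose g j := (map_poly (@mpolyC n k) (p j)).[mesym n k j].
pose d j := (size (p j)).-1.
pose fix s r := if r is r'.+1 then ((r * d r)%N, g r) :: s r' else [::].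
have size_s r : size (s r) = r by elim: r => //= r ->.
have top r : [seq pihomog mdeg q.1 q.2 | q <- s r] = mesym_powers k n d r.
  elim: r => //= r ->; congr (_ :: _).
  by have [] := horner_top_form (pP r.+1).1 (ltn0Sn r) (dhomog_mesym n k r.+1).
have sP r q : q \in s r -> (msize q.2 <= q.1.+1)%N /\ \pi_Q q.2 \in P.
  elim: r => //= r IHr; rewrite inE => /orP[/eqP->|/IHr//]; split;
    last exact: (pP r.+1).2.
  by have [] := horner_top_form (pP r.+1).1 (ltn0Sn r) (dhomog_mesym n k r.+1).
pose f := [seq q.2 | q <- s face_bound].
have regf : weakly_regular (mono_ideal G) f.
  apply: (weakly_regular_initial (mono_idealP k G) (mono_idealP k G)).
  - exact: initial_mono_ideal.
  - by move=> q /sP[].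
  - by rewrite top; apply: reg.
have sz_f : size f = face_bound by rewrite size_map size_s.
have fP a : a \in f -> \pi_Q a \in P by case/mapP=> q /sP[_ qP] ->.
exists (fun i => \pi_Q f`_i); split; last by move=> i; apply/fP/mem_nth;
  rewrite sz_f.
have Ecodom : codom (fun i : 'I_face_bound => \pi_Q f`_i) = map \pi_Q f.
  apply: (@eq_from_nth _ 0); rewrite size_codom card_ord ?size_map
    ?size_s // => i lti.
  rewrite (nth_map 0) ?sz_f // /codom /image_mem (nth_map (Ordinal lti))
    ?size_enum_ord //.
  by rewrite nth_enum_ord.
apply/regular_sequenceP; rewrite Ecodom; split.
  move=> f1; have := idealr1 P => /negP; apply.
  apply: (ideal_adds_le (idealr_is_ideal P)) f1 =>
    [_ ->|_ /mapP[a /fP aP ->]] //.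
  exact: rpred0.
rewrite (weakly_regular_preim (@pi_surj _ M)).
by apply: weakly_regular_ext regf => a; rewrite -mem_monomial pi_eq0.
Qed.

Lemma origin_ideal : exists P : idealr Q, maximal_ideal P /\
  forall f, \pi_Q f \in P <-> f@_0%MM = 0.
Proof.
pose I := mono_ideal (k := k) (variables [set: 'I_n]).
have idI : is_ideal I := mono_idealP _ _.
have MI f : f \in M -> I f.
  move/mem_monomial=> fG; apply/mono_variables_setT/memN_msupp_eq0/negP=> /fG.
  exact/negP/nondivisible0.
have [J1 _] := image_ideal_prime idI MI (mono_variables_prime k [set: 'I_n]).
have [P PI] := idealr_of (image_ideal_ideal idI MI) J1.
have PE f : \pi_Q f \in P <-> f@_0%MM = 0.
  by rewrite PI (image_idealE idI MI); apply: mono_variables_setT.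
exists P; split=> // P' PP' y; have [f <-] := pi_surj y => fP'.
apply/PE; apply: contrapT => /eqP f0; have /negP := idealr1 P'; apply.
have fcP' : \pi_Q (f@_0%MM)%:MP \in P'.
  have -> : (f@_0%MM)%:MP = f - (f - (f@_0%MM)%:MP) by rewrite opprB
    addrC subrK.
  rewrite rmorphB rpredB //; apply/PP'/PE.
  by rewrite mcoeffB mcoeffC eqxx mulr1 subrr.
have := idealMr (\pi_Q (f@_0%MM)^-1%:MP) fcP'.
by rewrite -rmorphM -mpolyCM mulVf // mpolyC1 rmorph1.
Qed.

Lemma origin_chain (P : idealr Q) : (forall f, \pi_Q f \in P <-> f@_0%MM = 0) ->
  exists C : 'I_face_bound.+1 -> prime_idealr Q,
    (forall i j : 'I_face_bound.+1, (i < j)%N ->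
       {subset C i <= C j} /\ ~ {subset C j <= C i}) /\ C ord_max =i P.
Proof.
move=> PE; have [Z ZV cZ] := maximal_face.
(* [B i] adds the first [i] variables of a largest face [Z] to those outside [Z]; the primes so
   generated form the chain. *)
pose B i := ~: [set h in drop i (enum Z)].
have sz : size (enum Z) = face_bound by rewrite -cardE.
have MB i f : f \in M -> mono_ideal (variables (B i)) f.
  move/mem_monomial=> fG b /fG; apply: divisible_by_sub => g gG.
  have /variablesP[h hZ gh] := (radical_complexP _ ZV) g gG.
  apply/variablesP; exists h => //; move: hZ; rewrite !inE; apply: contra => hd.
  by rewrite -mem_enum; apply: mem_drop hd.
pose J i := image_ideal (M := M) (mono_ideal (variables (B i))).
have JE i f : J i (\pi_Q f) <-> mono_ideal (variables (B i)) f.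
  exact: image_idealE (mono_idealP _ _) (MB i) _.
have /choice[C CP] i : exists C : prime_idealr Q, forall y, y \in C <-> J i y.
  apply: prime_idealr_of; first exact: image_ideal_ideal (mono_idealP _ _)
    (MB i).
  exact: image_ideal_prime (mono_idealP _ _) (MB i) (mono_variables_prime _ _).
exists (fun i => C i); split=> [i j ij|y]; last first.
  have [f <-] := pi_surj y.
  have fE : \pi_Q f \in C face_bound <-> \pi_Q f \in P.
    rewrite CP JE PE -mono_variables_setT (_ : B face_bound = setT) //.
    by apply/setP=> h; rewrite /B -sz drop_size !inE.
  by apply/idP/idP => /fE.
have BB : B i \subset B j.
  apply/subsetP=> h; rewrite !inE; apply: contra.
  by rewrite -(subnKC (ltnW ij)) addnC -drop_drop; apply: mem_drop.
split=> [y|sub].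
  have [f <-] := pi_surj y; move=> /CP/JE fB; apply/CP/JE => b /fB.
  by case/variablesP=> h /(subsetP BB) hB bh; apply/variablesP; exists h.
have isz : (i < size (enum Z))%N by rewrite sz; apply: leq_trans ij _;
  rewrite -ltnS.
have [h0 _] : exists h0 : 'I_n, true by case: (enum Z) isz => [//|h s _];
  exists h.
pose h := nth h0 (enum Z) i.
have hi : h \notin B i.
  by rewrite !inE negbK (drop_nth h0) // mem_head.
have hj : h \in B j.
  rewrite !inE; apply/negP=> hd.
  have := enum_uniq Z; rewrite -(cat_take_drop j (enum Z)) cat_uniq =>
    /and3P[_ /hasPn/(_ h hd) + _].
  by case/negP; rewrite -[h](nth_take h0 ij) mem_nth // size_take; case: ifP.
have : \pi_Q 'X_h \in C i.
  by apply/sub/CP/JE/mono_idealX/variablesP; exists h; rewrite ?mnm1E ?eqxx.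
move=> /CP/JE/mono_idealX/variablesP[h' h'B]; rewrite mnm1E.
by case: eqP => // E; rewrite E h'B in hi.
Qed.

(** The colon ideals by ['X_[u]] along powers of the sequence form a chain as in [chain_size_le],
    and the first contains the socle variables of [u]. The last is proper once the powers exceed the
    degree of [u]. *)
Lemma regular_socle_le (P : idealr Q) d (x : 'I_d -> Q) u :
  (forall f, \pi_Q f \in P <-> f@_0%MM = 0) ->
  regular_sequence x -> (forall i, x i \in P) -> ~~ divisible_by G u ->
  (d <= n - #|socle_variables m u|)%N.
Proof.
move=> PE /regular_sequenceP[_ regx] xP nGu.
pose s := [seq repr y | y <- codom x].
have Es : map \pi_Q s = codom x.
  by rewrite -map_comp -[RHS]map_id; apply: eq_map => y /=; rewrite reprK.
have sz : size s = d by rewrite size_map size_codom card_ord.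
have s0 a : a \in s -> a@_0%MM = 0.
  by case/mapP=> _ /codomP[i ->] ->; apply/PE; rewrite reprK.
have idM : is_ideal (mono_ideal (k := k) G) := mono_idealP _ _.
have reg_s : weakly_regular (mono_ideal G) s.
  apply: (weakly_regular_ext (I := fun f => \pi_Q f = 0)).
    by move=> f; rewrite pi_eq0 mem_monomial.
  by apply/(weakly_regular_preim (@pi_surj _ M) (fun y => y = 0) s); rewrite Es.
pose N := (mdeg u).+1; pose y := [seq a ^+ N | a <- s].
have /weakly_regularP reg_y : weakly_regular (mono_ideal G) y.
  exact: weakly_regular_exp.
have szy : size y = d by rewrite size_map.
rewrite -szy; pose I i := colon (ideal_adds (mono_ideal (k := k) G) (take i y))
  'X_[u].
have idA i := ideal_addsP (take i y) idM.
have take_le i j f : (i <= j)%N -> ideal_adds (mono_ideal G) (take i y) f ->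
    ideal_adds (mono_ideal G) (take j y) f.
  move=> ij; apply: (ideal_adds_le (idA j)) => [g|a];
    first exact: ideal_adds_sub.
  by rewrite -(take_takel _ ij) => /mem_take; apply: ideal_adds_gen.
apply: (chain_size_le (I := I)).
- by move=> i; apply: colonP.
- by move=> i g _; apply: take_le.
- move=> i lti; rewrite /I /colon mulrC; have [_ _ IM] := idA i.+1; apply: IM.
  apply: ideal_adds_gen => //; rewrite (take_nth 0) // mem_rcons mem_head //.
- by move=> i g lti; rewrite /I /colon -mulrA; apply: reg_y.
- move=> f; apply: mono_variables_le; first exact: colonP.
  move=> h; rewrite inE => hG; rewrite /I /colon take0 -mpolyXD.
  by apply/mono_idealX; rewrite addmC.
rewrite /I /colon mul1r take_size => uI.
(* [J] contains [M] and the [N]-th powers, whose monomials have degree at least [N] because the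
   entries lack a constant term; yet ['X_[u]] has degree [N - 1]. *)
pose J f := {in msupp f, forall b, divisible_by G b \/ (N <= mdeg b)%N}.
have idJ : is_ideal J.
  split=> [b|f g fJ gJ b|f g gJ b]; first by rewrite msupp0.
    by move/msuppD_le; rewrite mem_cat => /orP[/fJ|/gJ].
  move/msuppM_le/allpairsP=> [[b1 b2] /= [_ /gJ b2J ->]].
  case: b2J => [b2G|b2N]; [left | right]; first by apply: divisible_by_mono
    b2G; apply: lem_addl.
  by rewrite mdegD (leq_trans b2N) // leq_addl.
have : J 'X_[u].
  apply: (ideal_adds_le idJ) uI => [f fG b /fG|]; first by left.
  move=> _ /mapP[a /s0 a0 ->] b ba; right; move: b ba; elim: (N) =>
    [//|e IHe] b.
  rewrite exprS => /msuppM_le/allpairsP[[b1 b2] /= [b1a /IHe b2e ->]].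
  rewrite mdegD -add1n leq_add // lt0n mdeg_eq0.
  by apply: contraTneq b1a => ->; rewrite mcoeff_msupp a0 eqxx.
move/(_ u); rewrite msuppX mem_head => /(_ isT)[uG|]; last by rewrite ltnn.
by case/negP: nGu.
Qed.

End MonomialQuotient.

(** * Cohen-Macaulayness through the two complexes *)

Theorem theorem1p9 (k : fieldType) (n t : nat) (M : idealr {mpoly k[n]})
    (m : 'I_t -> 'X_{1..n}) (m_min : minimal_monomial_generators M m)
    (m_generic : generic m) :
  cohen_macaulay {ideal_quot M} <->
  complex_dim (scarf_complex m) + complex_dim (radical_complex M) = n%:Z - 2.
Proof.
set p := (\max_(s in scarf_complex m) #|s|)%N.
have scarf_le s : s \in scarf_complex m -> (#|s| <= p)%N.
  by move=> sS; rewrite /p (bigD1 s) //= leq_maxl.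
have [Z ZV cZ] := maximal_face m_min.
(* The complement of a largest face yields a socle monomial with at least that many variables, hence
   a Scarf face at least as large. *)
have codim_le_p : (n - face_bound M <= p)%N.
  have [||u nu le] := @socle_of_maximal_face n t m Z.
  - exact/(radical_complexP m_min).
  - move=> h hZ /(radical_complexP m_min)/face_bound_le.
    by rewrite cardsU1 hZ cZ add1n ltnn.
  have [s sS cs] := scarf_of_socle m_generic nu.
  by apply: leq_trans (scarf_le s sS); rewrite cs -cZ.
have face_le : (face_bound M <= n)%N by rewrite -cZ (leq_trans (max_card _))
  ?card_ord.
(* Each dimension is a largest face size minus one, which accounts for the [- 2]. *)
have -> : (complex_dim (scarf_complex m) + complex_dim
  (radical_complex M) = n%:Z - 2) <->
    (p + face_bound M = n)%N.
  by rewrite /complex_dim -/p -/(face_bound M); split; lia.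
split=> [[_ CM]|pn].
  have [P [maxP PE]] := origin_ideal m_min.
  (* At the origin a chain of primes generated by variables gives [face_bound M <= d], and socle
     monomials of Scarf faces give [p <= n - d]. *)
  have [d [[[x [regx xP]] _] [_ codim_max]]] := CM P maxP.
  have face_d : (face_bound M <= d)%N by apply/codim_max/(origin_chain m_min).
  have : (p <= n - d)%N.
    apply/bigmax_leqP=> s /socle_of_scarf[u nu su].
    have dle := regular_socle_le m_min PE regx xP nu.
    have le_n : (#|socle_variables m u| <= n)%N by rewrite
      (leq_trans (max_card _)) ?card_ord.
    have sub_swap a : (a <= n -> d <= n - a -> a <= n - d)%N by lia.
    exact: leq_trans su (sub_swap _ le_n dle).
  lia.
split; first exact: noetherian_quotient.
move=> P maxP; exists (face_bound M).
have [|x [regx xP]] := regular_in_maximal m_min _ maxP.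
  move=> d; apply: weakly_regular_generic => //.
  - exact: generic_codom.
  (* With [p = n - face_bound M], the bound on Scarf faces becomes the required socle bound. *)
  - move=> u nu; have [s sS cs] := scarf_of_socle m_generic nu.
    have := scarf_le s sS; rewrite cs => le_p.
    by apply: leq_trans le_p _; lia.
  - by apply: height_boundP => Z' /(radical_complexP m_min)/face_bound_le.
exact: (codim_depth_of_regular m_min (maximal_is_prime maxP) regx xP).
Qed.
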